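(* Suppose that $\langle f_n\rangle$ is a sequence of polynomials (with complex coefficients), that $f_n\to f$ weakly, where $f$ is a formal power series some coefficient of which is not $0$, and that $\mathcal{Z}(f_n)\subset\mathbb{H}$ for all $n$. Then $f$ represents an entire function in the Pólya-Obrechkoff class $\mathcal{PO}$, and $f_n\to f$ strongly.
   Context: $\mathbb{H}=\{z\in\mathbb{C}:\operatorname{Im} z\ge 0\}$ is the closed upper half plane. For an entire function $f$ not identically $0$, $\mathcal{Z}(f)=\{z\in\mathbb{C}: f(z)=0\}$; if $f$ is identically $0$, set $\mathcal{Z}(f)=\emptyset$. A sequence $\langle f_n\rangle$ of polynomials converges weakly if $\langle f_n^{(k)}(0)\rangle$ converges for every nonnegative integer $k$; its weak limit is then the formal power series $f$ whose $k$-th coefficient is $\frac{1}{k!}\lim_{n\to\infty}f_n^{(k)}(0)$ for every $k\ge 0$, and one writes $f_n\to f$ weakly. A sequence of entire functions converges strongly if it converges uniformly on compact subsets of $\mathbb{C}$. A formal power series represents an entire function if its radius of convergence is $\infty$; it is then identified with that entire function. The Pólya-Obrechkoff class $\mathcal{PO}$ is the collection of entire functions $f$ which can be represented in the form $$f(z)=cz^m e^{-\alpha z^2+\beta z}\prod_j\left(1-\frac{z}{a_j}\right)e^{z/a_j}\qquad(z\in\mathbb{C}),$$ where $c,\beta$ are complex constants, $m$ is a nonnegative integer, $\alpha\ge 0$, $a_1,a_2,\dots\in\mathbb{H}\setminus\{0\}$ (a finite, possibly empty, or infinite sequence), $\sum_j|a_j|^{-2}<\infty$, and $\sum_j\operatorname{Im}(-a_j^{-1})\le\operatorname{Im}\beta$.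 *)

(* Defs.v *)
From HB Require Import structures.
From mathcomp Require Import all_boot all_order all_algebra.
From mathcomp Require Import complex.
From mathcomp Require Import all_classical all_reals all_analysis.

Set Implicit Arguments.
Unset Strict Implicit.
Unset Printing Implicit Defensive.

Import Order.TTheory GRing.Theory Num.Theory.
Import numFieldTopology.Exports numFieldNormedType.Exports.

Local Open Scope classical_set_scope.
Local Open Scope ring_scope.

(* [R[i]^o] is the field [R[i]], equipped with the topology of its norm and
   regarded as a normed module over itself, so that [derivable] is complex
   differentiability. *)
Notation Cplx R := (R[i]^o).

Section Complex_functions.
Variable R : realType.
Local Notation C := (Cplx R).
Implicit Types (f : C -> C) (z : C).

Definition uhp : set C := [set z | 0 <= complex.Im z].

Definition entire f : Prop := forall z, derivable f z 1.

(* The first condition makes the zero set of the zero function empty. *)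
Definition zeros f : set C := [set z | (exists w, f w != 0) /\ f z = 0].

Definition cabs z : R := complex.Re `|z|.

Definition cexp z : C :=
  ((expR (complex.Re z) * cos (complex.Im z))
   +i* (expR (complex.Re z) * sin (complex.Im z)))%C.

End Complex_functions.
Arguments uhp R : clear implicits.

(* A formal power series is the sequence of its coefficients. *)
Section Formal_power_series.
Variable R : realType.
Local Notation C := (Cplx R).
Implicit Types (f : nat -> C) (z : C).

Definition power_series f z : nat -> C := series (fun k => f k * z ^+ k).

Definition radius_of_convergence f : \bar R :=
  ereal_sup [set (cabs z)%:E | z in [set z | cvgn (power_series f z)]].

Definition represents_entire f : Prop := radius_of_convergence f = +oo%E.

Definition fps_fun f : C -> C := fun z => limn (power_series f z).

Definition weakly_converges (fs : nat -> {poly R[i]}) : Prop :=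
  forall k, cvgn (fun n => ((fs n)^`(k)).[0] : C).

Definition weak_limit (fs : nat -> {poly R[i]}) : nat -> C :=
  fun k => (k`!%:R)^-1 * limn (fun n => ((fs n)^`(k)).[0] : C).

Definition cvg_weakly (fs : nat -> {poly R[i]}) f : Prop :=
  weakly_converges fs /\ f = weak_limit fs.

Definition cvg_strongly (fs : nat -> C -> C) (g : C -> C) : Prop :=
  {family compact, fs @ \oo --> g}.

End Formal_power_series.

Section Polya_Obrechkoff.
Variable R : realType.
Local Notation C := (Cplx R).

(* A finite or infinite sequence is given by [a : nat -> C] and a length
   [N : option nat]: its terms are the [a j] with [in_length N j], where
   [N = None] stands for an infinite sequence. *)
Definition in_length (N : option nat) (j : nat) : bool :=
  if N is Some n then (j < n)%N else true.

Definition partial_prod (N : option nat) (a : nat -> C) (z : C) : nat -> C :=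
  fun n => \prod_(0 <= j < n | in_length N j) ((1 - z / a j) * cexp (z / a j)).

(* The terms of the two infinite sums are nonnegative, so that these sums
   always exist in [\bar R]. *)
Definition PO : set (C -> C) := [set f | entire f /\
  exists (c beta : C) (m : nat) (alpha : R) (N : option nat) (a : nat -> C),
    [/\ 0 <= alpha,
        forall j, in_length N j -> (uhp R `\ 0) (a j),
        (\sum_(0 <= j <oo | in_length N j) (cabs (a j) ^- 2)%:E < +oo)%E,
        (\sum_(0 <= j <oo | in_length N j) (complex.Im (- (a j)^-1))%:E
           <= (complex.Im beta)%:E)%E &
        forall z, cvgn (partial_prod N a z) /\
          f z = c * z ^+ m * cexp (- (alpha%:C)%C * z ^+ 2 + beta * z)
                * limn (partial_prod N a z)]].

End Polya_Obrechkoff.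
Arguments PO R : clear implicits.

(* Main.v *)
Require Import Defs.
From HB Require Import structures.
From mathcomp Require Import all_boot all_order all_algebra.
From mathcomp Require Import complex ring lra zify cyclic separable cyclotomic.
From mathcomp Require Import all_classical all_reals all_analysis.
Set Implicit Arguments.
Unset Strict Implicit.
Unset Printing Implicit Defensive.
Import Order.TTheory GRing.Theory Num.Theory.
Import numFieldTopology.Exports numFieldNormedType.Exports.
Local Open Scope classical_set_scope.
Local Open Scope ring_scope.

(* Let [w] range over the inverse roots of [f_n], so that [Im w <= 0].  When
   [f(0) != 0], the first two coefficients of [f_n / f_n(0)] determine
   [\sum w] and [\sum w^2], hence bound [\sum |w|^2]; the factorization
   [f_n(z) = f_n(0) exp(- z \sum w) \prod (1 - w z) exp(w z)] then bounds the
   [f_n] on every disc, and Cauchy's estimates turn weak convergence into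
   strong convergence.  When [f] vanishes to order [m] at [0], apply this to
   the [m]-th derivatives, whose roots lie in [H] by Gauss-Lucas.
   For the product formula, [m] roots tending to [0] can be divided out, so let
   [m = 0].  Order the [w] by decreasing modulus and take limits [om_j] of the
   [j]-th ones along an ultrafilter.  All but the first [J] of them are
   [O(1 / sqrt J)], so the corresponding factors [(1 - w z) exp(w z)]
   multiply up to [exp(- z^2 / 2 \sum_(j >= J) w_j^2)] with an error tending to
   [0] as [J] grows.  As [\sum |Im w|] stays bounded, the limit of
   [\sum_(j >= J) w_j^2] is real and nonnegative: it is [2 alpha]. *)

(** The estimates are proved for polynomials, uniformly in [n], and only then passed to the limit;
    no contour integral and no Hurwitz theorem enters. Averaging over roots of unity gives Cauchy's
    estimate, multiplying over them gives a minimum modulus principle, and the latter produces the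
    roots of [f_n] that tend to a zero of [f] at [0]. The obstacle is that limits do not commute
    with sums over the roots. Ever more, ever smaller [w] can carry a fixed part of [\sum w^2] to
    the limit, as in [(1 - z^2 / n)^n -> exp(- z^2)]: this lost mass is the Gaussian factor. No
    higher power leaves a trace, because [\sum |w|^3] over a tail is at most [max |w|] times the
    bounded [\sum |w|^2]. The mass lost by [\sum w] is absorbed by [beta], which is why the
    condition on the imaginary parts is an inequality. An ultrafilter provides all limits [om_j] at
    once; as [f_n(z)] converges along the whole sequence, a formula obtained along the ultrafilter
    already concerns [f]. *)

(** * The real-valued modulus and convergence in C *)

Section Modulus.
Variable R : realType.
Local Notation C := (Cplx R).
Local Notation Re := (@complex.Re R).
Local Notation Im := (@complex.Im R).
Implicit Types z w : C.

Lemma cabsE z : cabs z = Num.sqrt (Re z ^+ 2 + Im z ^+ 2).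
Proof. by rewrite /cabs normc_def. Qed.

Lemma normC_cabs z : `|z| = (cabs z)%:C%C.
Proof. by rewrite cabsE normc_def. Qed.

Lemma cabs_ge0 z : 0 <= cabs z.
Proof. by rewrite cabsE sqrtr_ge0. Qed.

Lemma cabs_sqr z : cabs z ^+ 2 = Re z ^+ 2 + Im z ^+ 2.
Proof. by rewrite cabsE sqr_sqrtr // addr_ge0 ?sqr_ge0. Qed.

Lemma cabsM z w : cabs (z * w) = cabs z * cabs w.
Proof. by apply: (@complexI R); rewrite rmorphM -!normC_cabs normrM. Qed.

Lemma cabs0 : cabs (0 : C) = 0.
Proof. by apply: (@complexI R); rewrite -normC_cabs normr0. Qed.

Lemma cabs1 : cabs (1 : C) = 1.
Proof. by apply: (@complexI R); rewrite -normC_cabs normr1. Qed.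

Lemma cabsN z : cabs (- z) = cabs z.
Proof. by apply: (@complexI R); rewrite -!normC_cabs normrN. Qed.

Lemma cabs_distC z w : cabs (z - w) = cabs (w - z).
Proof. by rewrite -cabsN opprB. Qed.

Lemma cabsX z n : cabs (z ^+ n) = cabs z ^+ n.
Proof. by elim: n => [|n IH]; rewrite ?expr0 ?cabs1 // !exprS cabsM IH. Qed.

Lemma ler_cabsD z w : cabs (z + w) <= cabs z + cabs w.
Proof.
have := @ler_normD _ _ z w.
by rewrite !normC_cabs -rmorphD lecR.
Qed.

Lemma ler_cabsB z w : cabs (z - w) <= cabs z + cabs w.
Proof. by rewrite -(cabsN w) ler_cabsD. Qed.

Lemma lerB_cabsD z w : cabs z - cabs w <= cabs (z + w).
Proof. by rewrite lerBlDr -{1}(addrK w z); apply: ler_cabsB. Qed.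

Lemma cabs_eq0 z : (cabs z == 0) = (z == 0).
Proof.
by rewrite -(normr_eq0 z) normC_cabs -(inj_eq (@complexI R)).
Qed.

Lemma cabsV z : cabs z^-1 = (cabs z)^-1.
Proof.
have [->|z0] := eqVneq z 0; first by rewrite invr0 cabs0 invr0.
have z0' : cabs z != 0 by rewrite cabs_eq0.
by apply: (mulIf z0'); rewrite -cabsM !mulVf // cabs1.
Qed.

Lemma cabs_gt0 z : (0 < cabs z) = (z != 0).
Proof. by rewrite lt_neqAle cabs_ge0 andbT eq_sym cabs_eq0. Qed.

Lemma cabs_sum I (r : seq I) (P : pred I) (F : I -> C) :
  cabs (\sum_(i <- r | P i) F i) <= \sum_(i <- r | P i) cabs (F i).
Proof.
elim/big_rec2: _ => [|i x y _ IH]; first by rewrite cabs0.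
exact: le_trans (ler_cabsD _ _) (lerD _ _).
Qed.

Lemma cabs_prod I (r : seq I) (P : pred I) (F : I -> C) :
  cabs (\prod_(i <- r | P i) F i) = \prod_(i <- r | P i) cabs (F i).
Proof.
by elim/big_rec2: _ => [|i x y _ IH]; rewrite ?cabs1 // cabsM IH.
Qed.

Lemma ler_Re_cabs z : `|Re z| <= cabs z.
Proof.
rewrite -(@ler_pXn2r _ 2) ?nnegrE ?cabs_ge0 // cabs_sqr real_normK ?num_real //.
by rewrite lerDl sqr_ge0.
Qed.

Lemma ler_Im_cabs z : `|Im z| <= cabs z.
Proof.
rewrite -(@ler_pXn2r _ 2) ?nnegrE ?cabs_ge0 // cabs_sqr real_normK ?num_real //.
by rewrite lerDr sqr_ge0.
Qed.

Lemma ler_cabs_ReIm z : cabs z <= `|Re z| + `|Im z|.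
Proof.
rewrite -(@ler_pXn2r _ 2) ?nnegrE ?cabs_ge0 ?addr_ge0 // cabs_sqr.
rewrite sqrrD !real_normK ?num_real // -addrA [_ *+ 2 + _]addrC addrA.
by rewrite lerDl mulrn_wge0 // mulr_ge0.
Qed.

Lemma cabs_real (x : R) : cabs (x%:C%C : C) = `|x|.
Proof. by rewrite cabsE /= expr0n addr0 sqrtr_sqr. Qed.

Lemma cabs_nat n : cabs (n%:R : C) = n%:R.
Proof.
have -> : (n%:R : C) = (n%:R : R)%:C%C by rewrite rmorph_nat.
by rewrite cabs_real normr_nat.
Qed.

Lemma cvgCP (T : Type) (F : set_system T) {FF : Filter F} (u : T -> C) (l : C) :
  u x @[x --> F] --> l <->
  forall e : R, 0 < e -> \forall x \near F, cabs (l - u x) < e.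
Proof.
split=> [/cvgrPdist_lt ul e e0|ul].
  have e0' : 0 < e%:C%C :> R[i] by rewrite ltcR.
  by apply: filterS (ul _ e0') => x; rewrite normC_cabs ltcR.
apply/cvgrPdist_lt => e e0.
have er : e = (Re e)%:C%C by apply/esym/RRe_real/gtr0_real.
have e0' : 0 < Re e by rewrite er ltcR in e0.
apply: filterS (ul _ e0') => x.
by rewrite normC_cabs er ltcR.
Qed.

Lemma cvgC_ReIm (T : Type) (F : set_system T) {FF : Filter F} (u : T -> C) (l : C) :
  (Re (u x)) @[x --> F] --> Re l -> (Im (u x)) @[x --> F] --> Im l ->
  u x @[x --> F] --> l.
Proof.
move=> /cvgrPdist_lt ur /cvgrPdist_lt ui; apply/cvgCP => e e0.
have e2 : 0 < e / 2 by rewrite divr_gt0.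
apply: filterS2 (ur _ e2) (ui _ e2) => x h1 h2.
apply: le_lt_trans (ler_cabs_ReIm _) _; rewrite !raddfB /=; lra.
Qed.

Lemma cvgC_Re (T : Type) (F : set_system T) {FF : Filter F} (u : T -> C) (l : C) :
  u x @[x --> F] --> l -> (Re (u x)) @[x --> F] --> Re l.
Proof.
move/cvgCP => ul; apply/cvgrPdist_lt => e e0.
apply: filterS (ul _ e0) => x; apply: le_lt_trans.
by rewrite -raddfB ler_Re_cabs.
Qed.

Lemma cvgC_Im (T : Type) (F : set_system T) {FF : Filter F} (u : T -> C) (l : C) :
  u x @[x --> F] --> l -> (Im (u x)) @[x --> F] --> Im l.
Proof.
move/cvgCP => ul; apply/cvgrPdist_lt => e e0.
apply: filterS (ul _ e0) => x; apply: le_lt_trans.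
by rewrite -raddfB ler_Im_cabs.
Qed.

Lemma cvg_cabs (T : Type) (F : set_system T) {FF : Filter F} (u : T -> C) (l : C) :
  u x @[x --> F] --> l -> (cabs (u x)) @[x --> F] --> cabs l.
Proof.
move/cvgCP => ul; apply/cvgrPdist_lt => e e0.
apply: filterS (ul _ e0) => x; apply: le_lt_trans.
rewrite ler_norml lerBrDr addrC lerBlDr.
have := lerB_cabsD l (- u x); have := lerB_cabsD (u x) (- l).
rewrite !cabsN (cabs_distC (u x)) => h1 h2; apply/andP; split; lra.
Qed.

End Modulus.

(** * Second-order Taylor estimates for the complex exponential *)

Section Exponential.
Variable R : realType.
Local Notation C := (Cplx R).
Local Notation Re := (@complex.Re R).
Local Notation Im := (@complex.Im R).
Implicit Types z w u : C.

Lemma expR1_le4 : expR 1 <= 4 :> R.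
Proof.
have h : 1 / 2 <= expR (- (1 / 2)) :> R.
  by apply: le_trans (expR_ge1Dx _); lra.
have e0 : 0 < expR (1 / 2) :> R := expR_gt0 _.
have e2 : expR (1 / 2) * expR (- (1 / 2)) = 1 :> R by rewrite -expRD subrr expR0.
have -> : expR 1 = expR (1 / 2) * expR (1 / 2) :> R.
  by rewrite -expRD; congr expR; lra.
have : expR (1 / 2) <= 2 :> R by nra.
nra.
Qed.

(** The mean value theorem gains one power of [x] and keeps the constant [K]. Climbing from the
    highest derivative down to the function yields the Taylor remainders below. *)
Lemma taylor_step (F dF : R -> R) (K : R) (n : nat) : 0 <= K ->
  (forall x : R, is_derive x (1 : R) F (dF x)) -> F 0 = 0 ->
  (forall x, `|x| <= 1 -> `|dF x| <= K * `|x| ^+ n) ->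
  forall x, `|x| <= 1 -> `|F x| <= K * `|x| ^+ n.+1.
Proof.
move=> K0 hF F0 hd x x1.
have cF a b : {within `[a, b], continuous F}.
  apply: continuous_subspaceT => y.
  by apply/differentiable_continuous/derivable1_diffP; case: (hF y).
suff [c hc ->] : exists2 c, `|c| <= `|x| & F x = dF c * x.
  rewrite normrM exprSr mulrA; apply: ler_wpM2r => //.
  apply: le_trans (hd _ (le_trans hc x1)) _.
  by apply: ler_wpM2l => //; apply: lerXn2r.
case: (lerP 0 x) => x0.
  have [c hc h] := @MVT_segment R F dF 0 x x0 (fun y _ => hF y) (cF _ _).
  exists c; last by rewrite F0 !subr0 in h.
  move: hc; rewrite in_itv /= => /andP[c0 cx].
  by rewrite !ger0_norm.
have [c hc h] := @MVT_segment R F dF x 0 (ltW x0) (fun y _ => hF y) (cF _ _).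
exists c; last by rewrite F0 !sub0r mulrN in h; apply: oppr_inj.
move: hc; rewrite in_itv /= => /andP[cx c0].
by rewrite !ler0_norm ?lerN2 // ltW.
Qed.

Lemma expR_taylor2 (x : R) : `|x| <= 1 ->
  `|expR x - (1 + x + x ^+ 2 / 2)| <= 4 * `|x| ^+ 3.
Proof.
have d3 (y : R) : `|y| <= 1 -> `|expR y| <= 4 * `|y| ^+ 0.
  move=> y1; rewrite expr0 mulr1 ger0_norm ?expR_ge0 //.
  apply: le_trans expR1_le4; rewrite ler_expR.
  exact: le_trans (ler_norm _) y1.
have d2 : forall y : R, `|y| <= 1 -> `|expR y - 1| <= 4 * `|y| ^+ 1.
  apply: (taylor_step (dF := expR)) => //; last by rewrite expR0 subrr.
  by move=> y; apply: is_derive_eq; rewrite subr0.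
have d1 : forall y : R, `|y| <= 1 -> `|expR y - (1 + y)| <= 4 * `|y| ^+ 2.
  apply: (taylor_step (dF := fun y => expR y - 1)) => //.
    by move=> y; apply: is_derive_eq; rewrite add0r.
  by rewrite expR0 addr0 subrr.
move: x; apply: (taylor_step (dF := fun y => expR y - (1 + y))) => //.
  move=> y; apply: is_derive_eq.
  by rewrite add0r /GRing.scale /=; field.
by rewrite expR0 addr0 expr0n mul0r addr0 subrr.
Qed.

Lemma sin_taylor1 (x : R) : `|x| <= 1 -> `|sin x - x| <= `|x| ^+ 3.
Proof.
have d2 : forall y : R, `|y| <= 1 -> `|sin y| <= 1 * `|y| ^+ 1.
  apply: (taylor_step (dF := cos)) => //; first exact: sin0.
  by move=> y _; rewrite expr0 mulr1 cos_max.
have d1 : forall y : R, `|y| <= 1 -> `|cos y - 1| <= 1 * `|y| ^+ 2.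
  apply: (taylor_step (dF := fun y => - sin y)) => //.
  - by move=> y; apply: is_derive_eq; rewrite subr0.
  - by rewrite cos0 subrr.
  - by move=> y; rewrite normrN; apply: d2.
move=> x1; rewrite -[leRHS]mul1r; move: x x1.
apply: (taylor_step (dF := fun y => cos y - 1)) => //.
by rewrite sin0 subrr.
Qed.

Lemma cos_taylor2 (x : R) : `|x| <= 1 -> `|cos x - (1 - x ^+ 2 / 2)| <= `|x| ^+ 3.
Proof.
(* One more step above the sine gives order four; it is weakened so that all remainders are
   cubic. *)
move=> x1; apply: (@le_trans _ _ (1 * `|x| ^+ 4)); last first.
  by rewrite mul1r exprS ler_piMl // exprn_ge0.
move: x x1; apply: (taylor_step (dF := fun y => - (sin y - y))) => //.
- move=> y; apply: is_derive_eq.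
  by rewrite /GRing.scale /=; field.
- by rewrite cos0 expr0n mul0r subr0 subrr.
- by move=> y y1; rewrite mul1r normrN; apply: sin_taylor1.
Qed.

Lemma complex_eqP z w : Re z = Re w -> Im z = Im w -> z = w.
Proof. by case: z w => [a b] [c d] /= -> ->. Qed.

Lemma Re_M z w : Re (z * w) = Re z * Re w - Im z * Im w.
Proof. by case: z w => [a b] [c d]. Qed.

Lemma Im_M z w : Im (z * w) = Re z * Im w + Im z * Re w.
Proof. by case: z w => [a b] [c d]. Qed.

Lemma cexpD z w : cexp (z + w) = cexp z * cexp w.
Proof.
apply: complex_eqP; rewrite ?Re_M ?Im_M /= !raddfD /= expRD ?cosD ?sinD; ring.
Qed.

Lemma cexp0 : cexp (0 : C) = 1.
Proof. by rewrite /cexp /= expR0 cos0 sin0 mulr1 mulr0. Qed.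

Lemma cabs_cexp z : cabs (cexp z) = expR (Re z).
Proof.
by rewrite cabsE /= !exprMn -mulrDr cos2Dsin2 mulr1 sqrtr_sqr ger0_norm ?expR_ge0.
Qed.

Lemma cexp_neq0 z : cexp z != 0.
Proof. by rewrite -cabs_gt0 cabs_cexp expR_gt0. Qed.

Lemma cexp_sum I (r : seq I) (P : pred I) (F : I -> C) :
  cexp (\sum_(i <- r | P i) F i) = \prod_(i <- r | P i) cexp (F i).
Proof.
elim/big_rec2: _ => [|i x y _ <-]; [exact: cexp0|exact: cexpD].
Qed.

Lemma cvg_cexp (T : Type) (F : set_system T) {FF : Filter F} (u : T -> C)
    (l : C) :
  u x @[x --> F] --> l -> (cexp (u x) : C) @[x --> F] --> (cexp l : C).
Proof.
move=> ul; have ur := @cvgC_Re _ _ _ FF _ _ ul; have ui := @cvgC_Im _ _ _ FF _ _ ul.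
have er : expR (Re (u x)) @[x --> F] --> expR (Re l).
  exact: (@continuous_cvg _ _ _ F _ _ _ _ (@continuous_expR R _) ur).
have ec : cos (Im (u x)) @[x --> F] --> cos (Im l).
  exact: (@continuous_cvg _ _ _ F _ _ _ _ (@continuous_cos R _) ui).
have es : sin (Im (u x)) @[x --> F] --> sin (Im l).
  exact: (@continuous_cvg _ _ _ F _ _ _ _ (@continuous_sin R _) ui).
by apply: cvgC_ReIm => /=; apply: cvgM.
Qed.

Lemma cabs_scale (r : R) z : cabs (r%:C%C * z) = `|r| * cabs z.
Proof. by rewrite cabsM cabs_real. Qed.

(** With [u = x + i y], replacing [expR x] and [cis] by their quadratic polynomials costs [a] and
    [d], and [rem] holds the terms of degree above two in the product of these polynomials. The
    constant is 4 + (5/2) * 2 + 2 = 11. *)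
Lemma cexp_taylor2 u : cabs u <= 1 ->
  cabs (cexp u - (1 + u + u ^+ 2 / 2)) <= 11 * cabs u ^+ 3.
Proof.
move=> u1; set t := cabs u; have t0 : 0 <= t := cabs_ge0 u.
set x := Re u; set y := Im u.
have xt : `|x| <= t := ler_Re_cabs u.
have yt : `|y| <= t := ler_Im_cabs u.
have x1 : `|x| <= 1 := le_trans xt u1.
have y1 : `|y| <= 1 := le_trans yt u1.
have xt3 : `|x| ^+ 3 <= t ^+ 3 by apply: lerXn2r.
have yt3 : `|y| ^+ 3 <= t ^+ 3 by apply: lerXn2r.
set a := expR x - (1 + x + x ^+ 2 / 2).
have ha : `|a| <= 4 * t ^+ 3.
  by apply: le_trans (expR_taylor2 x1) _; rewrite ler_pM2l.
set b := cos y - (1 - y ^+ 2 / 2).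
have hb : `|b| <= t ^+ 3 := le_trans (cos_taylor2 y1) yt3.
set c := sin y - y.
have hc : `|c| <= t ^+ 3 := le_trans (sin_taylor1 y1) yt3.
set X := 1 + x + x ^+ 2 / 2.
have hX : `|X| <= 5 / 2.
  move: x1; rewrite /X !ler_norml => /andP[? ?]; apply/andP; split; nra.
pose cis : C := (cos y +i* sin y)%C.
pose d : C := (b +i* c)%C.
pose rem : C := ((- (x * y ^+ 2) / 2 - x ^+ 2 * y ^+ 2 / 4) +i* (x ^+ 2 * y / 2))%C.
have -> : cexp u - (1 + u + u ^+ 2 / 2) =
    a%:C%C * cis + X%:C%C * d + rem.
  have h2 : (2^-1 : C) = (2^-1 : R)%:C%C by rewrite fmorphV rmorph_nat.
  have -> : u = (x +i* y)%C by apply: complex_eqP.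
  rewrite h2 /cexp /cis /d /rem /a /b /c /X expr2.
  by apply: complex_eqP => /=; field.
have hcis : cabs cis = 1 by rewrite cabsE /= cos2Dsin2 sqrtr1.
have hd : cabs d <= 2 * t ^+ 3.
  by apply: le_trans (ler_cabs_ReIm _) _ => /=; rewrite mulr_natl mulr2n lerD.
have t3 : 0 <= t ^+ 3 by rewrite exprn_ge0.
have hrem : cabs rem <= 2 * t ^+ 3.
  apply: le_trans (ler_cabs_ReIm _) _ => /=.
  have x2 : `|x| ^+ 2 <= t ^+ 2 by apply: lerXn2r.
  have y2 : `|y| ^+ 2 <= t ^+ 2 by apply: lerXn2r.
  have m1 : `|x * y ^+ 2| <= t ^+ 3.
    by rewrite normrM normrX [t ^+ 3]exprS; apply: ler_pM => //; apply: exprn_ge0.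
  have m2 : `|x ^+ 2 * y| <= t ^+ 3.
    by rewrite normrM normrX [t ^+ 3]exprSr; apply: ler_pM => //; apply: exprn_ge0.
  have m3 : `|x ^+ 2 * y ^+ 2| <= t ^+ 3.
    have -> : x ^+ 2 * y ^+ 2 = x ^+ 2 * y * y by ring.
    by rewrite normrM -[t ^+ 3]mulr1; apply: ler_pM.
  have n1 := ler_normD (- (x * y ^+ 2) / 2) (- (x ^+ 2 * y ^+ 2 / 4)).
  move: n1; rewrite !normrM !normrN !normrM !normfV !normr_nat.
  rewrite -!normrM; lra.
apply: le_trans (ler_cabsD _ _) _.
apply: le_trans (lerD (ler_cabsD _ _) (lexx _)) _.
rewrite !cabs_scale hcis mulr1.
have : `|X| * cabs d <= 5 / 2 * (2 * t ^+ 3).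
  by apply: ler_pM => //; apply: cabs_ge0.
lra.
Qed.

End Exponential.

(** * Weierstrass primary factors of genus one *)

Section Primary_factors.
Variable R : realType.
Local Notation C := (Cplx R).
Local Notation Re := (@complex.Re R).
Local Notation Im := (@complex.Im R).
Implicit Types z w u : C.

Definition primary_factor u : C := (1 - u) * cexp u.

Lemma cabs_1B_sqr u : cabs (1 - u) ^+ 2 <= expR (cabs u ^+ 2 - 2 * Re u).
Proof.
apply: le_trans (expR_ge1Dx _).
rewrite !cabs_sqr !raddfB /=; nra.
Qed.

(** The exponential cancels the term of [|1 - u|^2] that is linear in [Re u]. Only [|u|^2] remains,
    so products are controlled by [\sum |w|^2] without any bound on [\sum |w|]. *)
Lemma cabs_primary_factor u : cabs (primary_factor u) <= expR (cabs u ^+ 2 / 2).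
Proof.
rewrite -(@ler_pXn2r _ 2) ?nnegrE ?cabs_ge0 ?expR_ge0 //.
rewrite cabsM exprMn cabs_cexp -!expRM_natl.
have -> : 2%:R * (cabs u ^+ 2 / 2) = (cabs u ^+ 2 - 2 * Re u) + 2%:R * Re u :> R.
  by field.
by rewrite expRD ler_wpM2r ?expR_ge0 // cabs_1B_sqr.
Qed.

Lemma prod_1B_primary_factor (s : seq C) z :
  \prod_(w <- s) (1 - w * z) =
  cexp (- ((\sum_(w <- s) w) * z)) * \prod_(w <- s) primary_factor (w * z).
Proof.
rewrite mulr_suml -sumrN cexp_sum -big_split /=; apply: eq_bigr => w _.
by rewrite /primary_factor mulrCA -cexpD addNr cexp0 mulr1.
Qed.

Lemma cabs_prod_primary_factor (s : seq C) z (M : R) :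
  \sum_(w <- s) cabs w ^+ 2 <= M ->
  cabs (\prod_(w <- s) primary_factor (w * z)) <= expR (M * cabs z ^+ 2 / 2).
Proof.
move=> hM.
apply: (@le_trans _ _ (expR (\sum_(w <- s) cabs (w * z) ^+ 2 / 2))).
  rewrite cabs_prod expR_sum; apply: ler_prod => w _.
  by rewrite cabs_ge0 cabs_primary_factor.
rewrite ler_expR -mulr_suml ler_wpM2r //.
under eq_bigr do rewrite cabsM exprMn.
by rewrite -mulr_suml ler_wpM2r ?sqr_ge0.
Qed.

Lemma cabs_cexp_le u : cabs (cexp u) <= expR (cabs u).
Proof.
by rewrite cabs_cexp ler_expR (le_trans (ler_norm _)) // ler_Re_cabs.
Qed.

(* Both functions are [1 - u^2 / 2 + O(u^3)]. *)
Lemma primary_factor_approx u : cabs u <= 1 ->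
  cabs (primary_factor u - cexp (- (u ^+ 2 / 2))) <= 24 * cabs u ^+ 3.
Proof.
move=> u1; set t := cabs u; have t0 : 0 <= t := cabs_ge0 u.
pose v : C := - (u ^+ 2 / 2).
have hv : cabs v = t ^+ 2 / 2 by rewrite cabsN cabsM cabsX cabsV cabs_nat.
have t2 : t ^+ 2 <= 1 by rewrite exprn_ile1.
have v1 : cabs v <= 1 by rewrite hv; lra.
have h1 := cexp_taylor2 u1; have h2 := cexp_taylor2 v1.
set r1 := cexp u - _ in h1; set r2 := cexp v - _ in h2.
have -> : primary_factor u - cexp (- (u ^+ 2 / 2)) =
    - (u ^+ 3 / 2) + (1 - u) * r1 - (v ^+ 2 / 2 + r2).
  by rewrite /primary_factor -/v /r1 /r2 /v; field.
apply: le_trans (ler_cabsB _ _) _.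
apply: le_trans (lerD (ler_cabsD _ _) (ler_cabsD _ _)) _.
have -> : cabs (- (u ^+ 3 / 2)) = t ^+ 3 / 2.
  by rewrite cabsN cabsM cabsX cabsV cabs_nat.
have -> : cabs (v ^+ 2 / 2) = (t ^+ 2 / 2) ^+ 2 / 2.
  by rewrite cabsM cabsX cabsV cabs_nat hv.
rewrite cabsM.
have h3 : cabs (1 - u) <= 2.
  by apply: le_trans (ler_cabsB _ _) _; rewrite cabs1 -/t; lra.
rewrite hv in h2.
have t3 : 0 <= t ^+ 3 by rewrite exprn_ge0.
have t4 : t ^+ 4 <= t ^+ 3 by rewrite exprS ler_piMl.
have t6 : t ^+ 6 <= t ^+ 3.
  by rewrite (exprD t 3 3) ler_piMl // exprn_ile1.
have h4 : cabs (1 - u) * cabs r1 <= 2 * (11 * t ^+ 3).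
  by apply: ler_pM => //; apply: cabs_ge0.
have e1 : (t ^+ 2 / 2) ^+ 2 = t ^+ 4 / 4 by field.
have e2 : (t ^+ 2 / 2) ^+ 3 = t ^+ 6 / 8 by field.
(* The constants add up to 1/2 + 2 * 11 + 1/8 + 11/8 = 24. *)
rewrite e1; rewrite e2 in h2; lra.
Qed.

(** Exchange the factors [A i] for [B i] one at a time. In each difference one factor is missing
    from the majorant; as [m i >= 0], the bound [expR (m i) >= 1] can be put in its place. *)
Lemma cabs_prodB I (s : seq I) (A B : I -> C) (m : I -> R) :
  (forall i, cabs (A i) <= expR (m i)) -> (forall i, cabs (B i) <= expR (m i)) ->
  (forall i, 0 <= m i) ->
  cabs (\prod_(i <- s) A i - \prod_(i <- s) B i) <=
  (\sum_(i <- s) cabs (A i - B i)) * expR (\sum_(i <- s) m i).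
Proof.
move=> hA hB m0; elim: s => [|i s IH].
  by rewrite !big_nil subrr cabs0 mul0r.
rewrite !big_cons.
set PA := \prod_(j <- s) A j; set PB := \prod_(j <- s) B j.
have -> : A i * PA - B i * PB = (A i - B i) * PB + A i * (PA - PB) by ring.
apply: le_trans (ler_cabsD _ _) _; rewrite !cabsM expRD mulrDl.
have hPB : cabs PB <= expR (\sum_(j <- s) m j).
  rewrite cabs_prod expR_sum; elim: (s) => [|j s' IH']; first by rewrite !big_nil.
  by rewrite !big_cons ler_pM ?cabs_ge0 // prodr_ge0 // => k _; apply: cabs_ge0.
apply: lerD.
  apply: ler_wpM2l; first exact: cabs_ge0.
  apply: le_trans hPB _; rewrite ler_peMl ?expR_ge0 //.
  by apply: le_trans (expR_ge1Dx _); rewrite lerDl.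
rewrite mulrCA; apply: ler_pM => //; exact: cabs_ge0.
Qed.

(** Each factor errs by a multiple of [|w|^3 <= d |w|^2], so the total error is of order [d M]: it
    is small when all [w] are small, however many there are. *)
Lemma prod_primary_factor_approx (s : seq C) (z : C) (d M : R) :
  0 <= d -> (forall w, w \in s -> cabs w <= d) -> d * cabs z <= 1 ->
  \sum_(w <- s) cabs w ^+ 2 <= M ->
  cabs (\prod_(w <- s) primary_factor (w * z)
        - cexp (- (z ^+ 2 / 2 * \sum_(w <- s) w ^+ 2)))
  <= 24 * d * M * cabs z ^+ 3 * expR (M * cabs z ^+ 2 / 2).
Proof.
move=> d0 hd hdz hM.
have z0 := cabs_ge0 z.
have -> : cexp (- (z ^+ 2 / 2 * \sum_(w <- s) w ^+ 2)) =
    \prod_(w <- s) cexp (- ((w * z) ^+ 2 / 2)).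
  rewrite -cexp_sum; congr cexp; rewrite mulr_sumr -sumrN.
  by apply: eq_bigr => w _; rewrite exprMn; field.
apply: le_trans (cabs_prodB (m := fun w => cabs (w * z) ^+ 2 / 2) _ _ _ _) _.
- by move=> w; apply: cabs_primary_factor.
- move=> w; rewrite cabs_cexp ler_expR.
  apply: le_trans (ler_norm _) _; apply: le_trans (ler_Re_cabs _) _.
  by rewrite cabsN cabsM cabsX cabsV cabs_nat.
- by move=> w; rewrite divr_ge0 ?exprn_ge0 ?cabs_ge0.
have M0 : 0 <= M by apply: le_trans hM; apply: sumr_ge0 => w _; rewrite sqr_ge0.
apply: ler_pM; rewrite ?expR_ge0 //.
- by apply: sumr_ge0 => w _; apply: cabs_ge0.
- apply: (@le_trans _ _ (\sum_(w <- s) 24 * d * cabs z ^+ 3 * cabs w ^+ 2)).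
    rewrite !big_seq; apply: ler_sum => w ws.
    have wz : cabs (w * z) <= 1.
      by rewrite cabsM; apply: le_trans hdz; apply: ler_wpM2r => //; apply: hd.
    apply: le_trans (primary_factor_approx wz) _.
    rewrite cabsM exprMn (_ : 24 * _ * _ * _ = 24 * (d * cabs w ^+ 2 * cabs z ^+ 3)).
      rewrite ler_pM2l //; apply: ler_wpM2r; first exact: exprn_ge0.
      rewrite [leLHS]exprS; apply: ler_wpM2r; first exact: sqr_ge0.
      exact: hd.
    by ring.
  rewrite -mulr_sumr (_ : 24 * d * M * _ = 24 * d * cabs z ^+ 3 * M); last by ring.
  by apply: ler_wpM2l => //; rewrite !mulr_ge0 ?exprn_ge0.
- rewrite ler_expR -mulr_suml ler_wpM2r // mulrC.
  under eq_bigr do rewrite cabsM exprMn.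
  by rewrite -mulr_suml mulrC ler_wpM2r ?sqr_ge0.
Qed.

End Primary_factors.

(** * Polynomials and their roots: Cauchy's estimate, minimum modulus, power sums, Gauss-Lucas *)

Section Polynomials.
Variable R : realType.
Local Notation C := (R[i]).
Local Notation Re := (@complex.Re R).
Local Notation Im := (@complex.Im R).
Implicit Types (z w : C) (p : {poly R[i]}) (s : seq R[i]).

Lemma prim_root_exists n : (0 < n)%N -> exists z : C, n.-primitive_root z.
Proof.
move=> n0; pose p : {poly R[i]} := 'X^n - 1.
have [r Dp] := closed_field_poly_normal p.
rewrite (monicP _) ?monicXnsubC // scale1r in Dp.
have rn1 : all n.-unity_root r.
  by apply/allP => z; rewrite -root_prod_XsubC -Dp.
have sz_r : (n < (size r).+1)%N by rewrite -(size_prod_XsubC r id) -Dp size_XnsubC.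
have [|z] := hasP (has_prim_root n0 rn1 _ sz_r); last by exists z.
by rewrite -separable_prod_XsubC -Dp separable_Xn_sub_1 // pnatr_eq0 -lt0n.
Qed.

Lemma cabs_prim_root n z : n.-primitive_root z -> cabs z = 1.
Proof.
move=> pz; have n0 := prim_order_gt0 pz.
apply: (@pexpIrn _ n) => //; rewrite ?nnegrE ?cabs_ge0 ?ler01 //.
by rewrite -cabsX (prim_expr_order pz) cabs1 expr1n.
Qed.

(** A discrete Cauchy formula: averaging [p (r x^i) x^(- i k)] over the [n]-th roots of unity
    isolates the [k]-th coefficient, because [n = size p] leaves no other index congruent to [k]. *)
Lemma cauchy_estimate p (r B : R) k : 0 <= r ->
  (forall z, cabs z = r -> cabs p.[z] <= B) -> cabs p`_k * r ^+ k <= B.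
Proof.
move=> r0 hB.
have B0 : 0 <= B.
  by apply: le_trans (hB r%:C%C _); rewrite ?cabs_ge0 // cabs_real ger0_norm.
case: (ltnP k (size p)) => [kp|pk]; last by rewrite nth_default // cabs0 mul0r.
set n := size p; have n0 : (0 < n)%N by apply: leq_trans kp.
have [x px] := prim_root_exists n0.
pose rc : C := (r%:C)%C.
(* [x ^+ (n - k)] is the inverse of [x ^+ k]. *)
have key : \sum_(i < n) p.[rc * x ^+ i] * (x ^+ (n - k)) ^+ i = n%:R * (p`_k * rc ^+ k).
  under eq_bigr => i _ do rewrite horner_coef mulr_suml.
  rewrite exchange_big /= (bigD1 (Ordinal kp)) //= [X in _ + X]big1 ?addr0.
    rewrite (eq_bigr (fun=> p`_k * rc ^+ k)).
      by rewrite sumr_const card_ord mulr_natl.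
    move=> i _; rewrite exprMn -!exprM.
    rewrite -!mulrA -exprD [(i * k)%N]mulnC -mulnDl subnKC; last exact: ltnW.
    by rewrite exprM (prim_expr_order px) expr1n mulr1.
  move=> j jk; pose y := x ^+ (j + (n - k)).
  rewrite (eq_bigr (fun i : 'I_n => p`_j * rc ^+ j * y ^+ i)); last first.
    move=> i _; rewrite exprMn -!exprM -!mulrA -exprD.
    by rewrite [(i * j)%N]mulnC -mulnDl.
  rewrite -mulr_sumr; suff -> : \sum_(i < n) y ^+ i = 0 by rewrite mulr0.
  have y1 : y - 1 != 0.
    (* The exponent [j + (n - k)] lies strictly between [0] and [2 n], so it is a multiple of [n]
       only if it equals [n], that is, if [j = k]. *)
    rewrite subr_eq0 /y -(prim_order_dvd px); apply: contra jk => /dvdnP[q hq].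
    apply/eqP/val_inj => /=; have := ltn_ord j; rewrite -/n in hq kp * => jn.
    have : (0 < q < 2)%N.
      apply/andP; split; rewrite lt0n || idtac.
        by apply/negP => /eqP q0; rewrite q0 mul0n in hq; lia.
      by rewrite -(ltn_pmul2r n0) -hq; lia.
    by move=> ?; have q1 : q = 1%N by [lia]; rewrite q1 in hq; lia.
  apply: (mulfI y1); rewrite mulr0 -subrX1 /y -exprM mulnC exprM.
  by rewrite (prim_expr_order px) expr1n subrr.
have n0R : (0 : R) < n%:R by rewrite ltr0n.
rewrite -(ler_pM2l n0R).
have -> : n%:R * (cabs p`_k * r ^+ k) = cabs (n%:R * (p`_k * rc ^+ k)).
  by rewrite !cabsM cabs_nat cabsX cabs_real ger0_norm.
rewrite -key; apply: le_trans (cabs_sum _ _ _) _.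
rewrite mulr_natl -[n in leRHS]card_ord -sumr_const; apply: ler_sum => i _.
rewrite cabsM !cabsX (cabs_prim_root px) !expr1n mulr1; apply: hB.
by rewrite cabsM cabs_real cabsX (cabs_prim_root px) expr1n mulr1 ger0_norm.
Qed.

Lemma prod_1B_prim_root n (x y : C) : n.-primitive_root x ->
  \prod_(i < n) (1 - y * x ^+ i) = 1 - y ^+ n.
Proof.
move=> px; have n0 := prim_order_gt0 px.
have [->|y0] := eqVneq y 0.
  rewrite expr0n gtn_eqF // subr0 big1 // => i _; by rewrite mul0r subr0.
(* Evaluate [X^n - 1 = \prod_i (X - x^i)] at the inverse of [y] and clear denominators. *)
have := congr1 (fun p => y ^+ n * p.[y^-1]) (factor_Xn_sub_1 px).
rewrite big_mkord horner_prod !hornerE.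
rewrite mulrBr mulr1 exprVn divff ?expf_neq0 // => <-.
rewrite -[n in y ^+ n]card_ord -prodr_const -big_split /=.
by apply: eq_bigr => i _; rewrite !hornerE mulrBr divff.
Qed.

(* [\prod_(x^N = 1) p (r x) = p(0)^N \prod_w (1 - (w r)^N)] as soon as
   [p = p(0) \prod_w (1 - w X)]. *)
Lemma minimum_modulus p s (r d : R) : p = p`_0 *: \prod_(w <- s) (1 - w *: 'X) ->
  0 <= r -> 0 <= d -> (forall w, w \in s -> cabs w * r <= 1) ->
  (forall z, cabs z = r -> d <= cabs p.[z]) -> d <= 2 * cabs p`_0.
Proof.
(* There are fewer than [n] factors [1 - (w r)^n], each of modulus at most [2]; their product is at
   most [2 ^+ n], which costs a factor [2] once [n]-th roots are taken. *)
move=> hp r0 d0 hs hd; set n := (size s).+1.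
have [x px] := prim_root_exists (ltn0Sn (size s)); rewrite -/n in px.
pose rc : C := (r%:C)%C.
have key : \prod_(i < n) p.[rc * x ^+ i] =
    p`_0 ^+ n * \prod_(w <- s) (1 - (w * rc) ^+ n).
  have hpz z : p.[z] = p`_0 * \prod_(w <- s) (1 - w * z).
    rewrite {1}hp hornerZ horner_prod; congr (_ * _).
    by apply: eq_bigr => w _; rewrite !hornerE.
  under [LHS]eq_bigr => i _ do rewrite hpz.
  rewrite big_split /= prodr_const card_ord; congr (_ * _).
  rewrite exchange_big /=; apply: eq_bigr => w _.
  rewrite -(prod_1B_prim_root _ px); apply: eq_bigr => i _.
  by rewrite mulrA.
have nd : d ^+ n <= cabs (\prod_(i < n) p.[rc * x ^+ i]).
  rewrite cabs_prod -[n in d ^+ n]card_ord -prodr_const.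
  apply: ler_prod => i _; rewrite d0 /=; apply: hd.
  by rewrite cabsM cabs_real cabsX (cabs_prim_root px) expr1n mulr1 ger0_norm.
rewrite -(@ler_pXn2r _ n) ?nnegrE ?mulr_ge0 ?cabs_ge0 //.
apply: le_trans nd _; rewrite key cabsM cabsX exprMn mulrC.
apply: ler_wpM2r; first by rewrite exprn_ge0 ?cabs_ge0.
apply: (@le_trans _ _ (2 ^+ size s)); last first.
  by rewrite /n exprS ler_peMl ?exprn_ge0 // ler1n.
rewrite cabs_prod; elim: (s) (hs) => [|w s' IH] hs'; first by rewrite big_nil.
rewrite big_cons [leRHS]exprS; apply: ler_pM; rewrite ?cabs_ge0 //.
- by apply: prodr_ge0 => *; apply: cabs_ge0.
- apply: le_trans (ler_cabsB _ _) _.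
  rewrite cabs1 cabsX cabsM cabs_real ger0_norm // lerD2l.
  by rewrite exprn_ile1 ?mulr_ge0 ?cabs_ge0 ?hs' ?mem_head.
- by apply: IH => v vs; apply: hs'; rewrite inE vs orbT.
Qed.

Lemma poly_roots_inverse p : p`_0 != 0 ->
  exists s, [/\ p = p`_0 *: \prod_(w <- s) (1 - w *: 'X),
    sorted (fun v w => cabs w <= cabs v) s &
    forall w, w \in s -> w != 0 /\ root p w^-1].
Proof.
move=> p0; have [r hr] := closed_field_poly_normal p.
set c := lead_coef p in hr.
have rP a : a \in r -> root p a.
  have c0 : c != 0.
    by apply: contraNneq p0 => c0; rewrite hr c0 scale0r coef0.
  by move=> ar; rewrite hr rootZ // root_prod_XsubC.
have r0 a : a \in r -> a != 0.
  by move/rP; apply: contraTneq => ->; rewrite /root horner_coef0.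
pose t := [seq a^-1 | a <- r].
have ht : p = p`_0 *: \prod_(w <- t) (1 - w *: 'X).
  have hq : \prod_(a <- r) ('X - a%:P) =
      (\prod_(a <- r) - a) *: \prod_(w <- t) (1 - w *: 'X).
    rewrite /t big_map; elim: (r) r0 => [|a r' IH] r0.
      by rewrite !big_nil scale1r.
    rewrite !big_cons IH; last by move=> b br; apply: r0; rewrite inE br orbT.
    rewrite -scalerAr [- a * _]mulrC -[in RHS]scalerA [- a *: (_ * _)]scalerAl; congr (_ *: (_ * _)).
    rewrite scalerBr scalerA mulNr divff ?r0 ?mem_head // scaleN1r opprK.
    by rewrite addrC -alg_polyC scaleNr.
  have {1}-> := hr; rewrite hq scalerA; congr (_ *: _).
  rewrite -horner_coef0 hr hq scalerA hornerZ horner_prod [X in _ = _ * X]big1 ?mulr1 // => w _.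
  by rewrite !hornerE ?mulr0 ?subr0.
exists (sort (fun v w => cabs w <= cabs v) t); split.
- by rewrite {1}ht; congr (_ *: _); apply: perm_big; rewrite perm_sym perm_sort.
- by apply: sort_sorted => v w; apply: le_total.
- move=> w; rewrite mem_sort => /mapP[a ar ->].
  by rewrite invrK invr_eq0 r0 // rP.
Qed.

(** The first two Newton identities, since [q_1] and [q_2] are, up to sign, the elementary symmetric
    functions of the [w]. *)
Lemma coef_prod_1BX s (q := \prod_(w <- s) (1 - w *: 'X)) :
  [/\ q`_0 = 1, q`_1 = - \sum_(w <- s) w &
      q`_1 ^+ 2 - 2 * q`_2 = \sum_(w <- s) w ^+ 2].
Proof.
rewrite {}/q; elim: s => [|w s [IH0 IH1 IH2]].
  by rewrite !big_nil !coef1 /= oppr0; split => //; rewrite mulr0 subr0 expr0n.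
rewrite !big_cons; set q := \prod_(w <- s) _ in IH0 IH1 IH2 *.
have hq k : ((1 - w *: 'X) * q)`_k = q`_k - w * (if k == 0%N then 0 else q`_k.-1).
  by rewrite mulrBl mul1r -scalerAl coefB coefZ coefXM.
rewrite !hq /= mulr0 subr0 IH0; split => //.
  by rewrite IH1 mulr1 opprD addrC.
by rewrite -IH2; ring.
Qed.

(* [|w|^2 = Re w^2 + 2 (Im w)^2], and the numbers [Im w] all have the same sign. *)
Lemma sum_cabs_sqr_le s : (forall w, w \in s -> Im w <= 0) ->
  \sum_(w <- s) cabs w ^+ 2 <=
  Re (\sum_(w <- s) w ^+ 2) + 2 * Im (\sum_(w <- s) w) ^+ 2.
Proof.
move=> hs.
have -> : \sum_(w <- s) cabs w ^+ 2 =
    Re (\sum_(w <- s) w ^+ 2) + 2 * \sum_(w <- s) Im w ^+ 2.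
  rewrite raddf_sum mulr_sumr -big_split /=; apply: eq_bigr => w _.
  by rewrite cabs_sqr expr2 Re_M; ring.
rewrite lerD2l ler_pM2l // raddf_sum /=.
(* The second conjunct gives the sign of the cross term in the induction. *)
suff [] : \sum_(w <- s) Im w ^+ 2 <= (\sum_(w <- s) Im w) ^+ 2 /\
  \sum_(w <- s) Im w <= 0 by [].
elim: s hs => [|w s IH] hs; first by rewrite !big_nil expr0n.
have [|h1 h2] := IH; first by move=> v vs; apply: hs; rewrite inE vs orbT.
rewrite !big_cons; have := hs w (mem_head _ _); split; nra.
Qed.

Lemma cabs_prod_1BX s z (M : R) : \sum_(w <- s) cabs w ^+ 2 <= M ->
  cabs (\prod_(w <- s) (1 - w * z)) <=
  expR (cabs (\sum_(w <- s) w) * cabs z + M * cabs z ^+ 2 / 2).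
Proof.
move=> hM; rewrite prod_1B_primary_factor cabsM expRD.
apply: ler_pM; rewrite ?cabs_ge0 //; last exact: cabs_prod_primary_factor.
by rewrite -cabsM -(cabsN (_ * z)) cabs_cexp_le.
Qed.

Lemma Im_inv_le0 z : 0 <= Im z -> Im z^-1 <= 0.
Proof.
case: z => a b /= b0; rewrite oppr_le0 divr_ge0 //.
by rewrite addr_ge0 ?sqr_ge0.
Qed.

Lemma Im_inv_gt0 z : Im z < 0 -> 0 < Im z^-1.
Proof.
case: z => a b /= b0; rewrite oppr_gt0 pmulr_llt0 // invr_gt0.
by rewrite ltr_wpDl ?sqr_ge0 // exprn_even_gt0 //= lt_eqF.
Qed.

Definition uhp_roots p := p != 0 /\ forall z, root p z -> 0 <= Im z.

(* Gauss-Lucas: the logarithmic derivative [\sum_a 1 / (z - a)] has positive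
   imaginary part on the open lower half plane. *)
Lemma uhp_roots_deriv p : uhp_roots p -> p^`() != 0 -> uhp_roots p^`().
Proof.
move=> [p0 hp] dp0; split => // z; apply: contraTT; rewrite -ltNge => z0.
have [r hr] := closed_field_poly_normal p.
set c := lead_coef p in hr; have c0 : c != 0 by rewrite lead_coef_eq0.
have rP a : a \in r -> 0 <= Im a.
  by move=> ar; apply: hp; rewrite hr rootZ // root_prod_XsubC.
(* The empty product has logarithmic derivative [0], so positivity can only start with the first
   root; a constant [p] is excluded afterwards by [dp0]. *)
have key s : (forall a, a \in s -> 0 <= Im a) ->
    (\prod_(a <- s) ('X - a%:P)).[z] != 0 /\
    (if s is [::] then True else
     0 < Im ((\prod_(a <- s) ('X - a%:P))^`().[z] / (\prod_(a <- s) ('X - a%:P)).[z])).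
  elim: s => [|a s IH] hs; first by rewrite big_nil hornerE oner_neq0.
  have [|h1 h2] := IH; first by move=> v vs; apply: hs; rewrite inE vs orbT.
  have za : Im (z - a) < 0 by rewrite raddfB /= subr_lt0 (lt_le_trans z0) ?hs ?mem_head.
  have za0 : z - a != 0 by apply: contraTneq za => ->; rewrite ltxx.
  rewrite big_cons derivM derivXsubC mul1r !hornerE; split; first exact: mulf_neq0.
  rewrite mulrDl invfM mulrCA divff // mulr1 mulrACA divff // mul1r raddfD /=.
  have h3 := Im_inv_gt0 za.
  case: s IH hs h1 h2 => [|b s] IH hs h1 h2; last exact: addr_gt0.
  by rewrite big_nil -polyC1 derivC horner0 mul0r addr0.
have [k1 k2] := key r rP.
case: r hr k1 k2 {rP key} => [|a r] hr k1 k2.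
  by move: dp0; rewrite hr big_nil derivZ -polyC1 derivC scaler0 eqxx.
rewrite /root hr derivZ hornerZ mulf_neq0 //.
by apply: contraTneq k2 => ->; rewrite mul0r ltxx.
Qed.

Lemma uhp_roots_derivn p n : uhp_roots p -> p^`(n) != 0 -> uhp_roots p^`(n).
Proof.
elim: n => [|n IH] // hp; rewrite derivnS => dp.
apply: uhp_roots_deriv => //; apply: IH => //.
by apply: contraNneq dp => ->; rewrite deriv0.
Qed.

End Polynomials.

(** * From coefficient bounds to entire limits and strong convergence *)

Section Weak_limits.
Variable R : realType.
Local Notation C := (Cplx R).
Local Notation Re := (@complex.Re R).
Local Notation Im := (@complex.Im R).
Implicit Types (fs : nat -> {poly R[i]}) (f a : nat -> C) (z : C) (p : {poly R[i]}).

Definition coef_cvg (fs : nat -> {poly R[i]}) (f : nat -> C) :=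
  forall k, ((fs n)`_k : C) @[n --> \oo] --> f k.

(** Local uniform boundedness, expressed on coefficients through Cauchy's estimates. In this form it
    passes to derivatives, to quotients by linear factors and to the limit series. *)
Definition coef_bounded (fs : nat -> {poly R[i]}) := forall r : R, 0 < r ->
  exists B : R, \forall n \near \oo, forall k, cabs ((fs n)`_k) * r ^+ k <= B.

Lemma sum_geometric_tail (a : nat -> R) (B : R) K N : 0 <= B ->
  (forall k, (K <= k)%N -> a k <= B * (1 / 2) ^+ k) ->
  \sum_(K <= k < N) a k <= 2 * B * (1 / 2) ^+ K.
Proof.
move=> B0 ha.
have [NK|KN] := leqP N K.
  by rewrite big_geq // !mulr_ge0 // exprn_ge0.
apply: (@le_trans _ _ (2 * B * (1 / 2) ^+ K - 2 * B * (1 / 2) ^+ N)); last first.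
  by rewrite gerBl !mulr_ge0 // exprn_ge0.
rewrite -(subnKC (ltnW KN)); elim: (N - K)%N => [|m IH].
  by rewrite addn0 big_geq // subrr.
rewrite addnS big_nat_recr ?leq_addr //=.
have := ha (K + m)%N (leq_addr _ _); rewrite [(1 / 2) ^+ (K + m).+1]exprS; lra.
Qed.

(** Staying within half of the radius turns a bound on the coefficients into geometric decay of
    ratio [1 / 2], against which every series below is compared. *)
Lemma cabs_term_le (c z : C) (r B : R) k : 2 * cabs z <= r ->
  cabs c * r ^+ k <= B -> cabs (c * z ^+ k) <= B * (1 / 2) ^+ k.
Proof.
move=> zr cB; rewrite cabsM cabsX.
have -> : cabs z ^+ k = (2 * cabs z) ^+ k * (1 / 2) ^+ k.
  by rewrite -exprMn; congr (_ ^+ _); field.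
rewrite mulrA ler_wpM2r ?exprn_ge0 //.
apply: le_trans cB; rewrite ler_wpM2l ?cabs_ge0 // lerXn2r ?nnegrE //.
  by rewrite mulr_ge0 ?cabs_ge0.
by apply: le_trans zr; rewrite mulr_ge0 ?cabs_ge0.
Qed.

Lemma cvg_power_series a (r B : R) z : 2 * cabs z <= r ->
  (forall k, cabs (a k) * r ^+ k <= B) -> cvgn (power_series a z).
Proof.
move=> zr aB.
have h k := cabs_term_le zr (aB k).
have B0 := le_trans (cabs_ge0 _) (h 0%N); rewrite expr0 mulr1 in B0.
have hc (g : C -> R) : (forall w, `|g w| <= cabs w) ->
    cvgn (series (fun k => g (a k * z ^+ k))).
  move=> hg; apply: normed_cvg.
  apply: (@series_le_cvg _ _ (geometric B (1 / 2))) => [k|k|k|].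
  - exact: normr_ge0.
  - by rewrite /= mulr_ge0 ?exprn_ge0.
  - exact: le_trans (hg _) (h k).
  - by apply: is_cvg_geometric_series; rewrite ger0_norm; lra.
have /cvg_ex[/= x hx] := hc Re (@ler_Re_cabs R).
have /cvg_ex[/= y hy] := hc Im (@ler_Im_cabs R).
apply/cvg_ex; exists ((x +i* y)%C : C).
apply: cvgC_ReIm => /=.
  by under eq_fun do rewrite /power_series /series /= raddf_sum.
by under eq_fun do rewrite /power_series /series /= raddf_sum.
Qed.

(** Only terms from [K] on are bounded, so [B] may depend on [K] and [z]; [fps_fun_lower_bound] uses
    it with [B] of order [|z|^K]. *)
Lemma power_series_tail_gen a (B : R) z K : cvgn (power_series a z) -> 0 <= B ->
  (forall k, (K <= k)%N -> cabs (a k * z ^+ k) <= B * (1 / 2) ^+ k) ->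
  cabs (fps_fun a z - \sum_(0 <= k < K) a k * z ^+ k) <= 2 * B * (1 / 2) ^+ K.
Proof.
move=> hl B0 h.
have hc : cabs (power_series a z n - \sum_(0 <= k < K) a k * z ^+ k) @[n --> \oo]
    --> cabs (fps_fun a z - \sum_(0 <= k < K) a k * z ^+ k).
  by apply: cvg_cabs; apply: cvgB; [exact: hl|exact: cvg_cst].
apply: (cvgr_to_le hc); exists K => // n /= Kn.
rewrite /power_series /series /= (big_cat_nat (leq0n K) Kn) //= [X in cabs X]addrC addKr.
by apply: le_trans (cabs_sum _ _ _) _; apply: sum_geometric_tail.
Qed.

Lemma power_series_tail a (r B : R) z K : 2 * cabs z <= r ->
  (forall k, cabs (a k) * r ^+ k <= B) ->
  cabs (fps_fun a z - \sum_(0 <= k < K) a k * z ^+ k) <= 2 * B * (1 / 2) ^+ K.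
Proof.
move=> zr aB.
have h k := cabs_term_le zr (aB k).
have B0 := le_trans (cabs_ge0 _) (h 0%N); rewrite expr0 mulr1 in B0.
by apply: power_series_tail_gen => //; apply: cvg_power_series zr aB.
Qed.

Lemma horner_tail p (r B : R) z K : 2 * cabs z <= r ->
  (forall k, cabs (p`_k) * r ^+ k <= B) ->
  cabs (p.[z] - \sum_(0 <= k < K) p`_k * z ^+ k) <= 2 * B * (1 / 2) ^+ K.
Proof.
move=> zr pB.
have h k := cabs_term_le zr (pB k).
have B0 := le_trans (cabs_ge0 _) (h 0%N); rewrite expr0 mulr1 in B0.
have -> : p.[z] = \sum_(0 <= k < maxn (size p) K) p`_k * z ^+ k.
  by rewrite big_mkord; apply: horner_coef_wide; rewrite leq_maxl.
rewrite (big_cat_nat (leq0n K) (leq_maxr _ K)) //= [X in cabs X]addrC addKr.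
by apply: le_trans (cabs_sum _ _ _) _; apply: sum_geometric_tail.
Qed.

Lemma coef_lim_bounded fs f (r B : R) : coef_cvg fs f -> 0 <= r ->
  (\forall n \near \oo, forall k, cabs ((fs n)`_k) * r ^+ k <= B) ->
  forall k, cabs (f k) * r ^+ k <= B.
Proof.
move=> hf r0 hB k.
have hc : cabs ((fs n)`_k) * r ^+ k @[n --> \oo] --> cabs (f k) * r ^+ k.
  by apply: cvgM; [apply: cvg_cabs; apply: hf|apply: cvg_cst].
by apply: (cvgr_to_le hc); apply: filterS hB => n; apply.
Qed.

Lemma pow2_cvg0 (B e : R) : 0 < e -> exists K, 2 * B * (1 / 2) ^+ K <= e.
Proof.
move=> e0.
have h : geometric (2 * B) (1 / 2 : R) n @[n --> \oo] --> (0 : R).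
  by apply: cvg_geometric; rewrite ger0_norm; lra.
have [K _ hK] := cvgr_le (0 : R) h e e0.
by exists K; apply: hK => /=.
Qed.

(** A bound on radius [2 r] makes both tails beyond some [K] at most [e / 4] on the whole disc,
    uniformly in [n]; the finitely many coefficients below [K] converge. *)
Lemma near_disc_horner fs f (r e : R) : coef_cvg fs f -> coef_bounded fs ->
  0 < r -> 0 < e ->
  \forall n \near \oo, forall z, cabs z <= r -> cabs (fps_fun f z - (fs n).[z]) < e.
Proof.
move=> hf hb r0 e0.
have [|B hB] := hb (2 * r); first by rewrite mulr_gt0.
have hfB := coef_lim_bounded hf (ltW (mulr_gt0 (ltr0n _ 2) r0)) hB.
have [|K hK] := @pow2_cvg0 B (e / 4); first by rewrite divr_gt0.
have hs : \forall n \near \oo, \sum_(0 <= k < K) cabs (f k - (fs n)`_k) * r ^+ k < e / 4.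
  have hc : \sum_(0 <= k < K) cabs (f k - (fs n)`_k) * r ^+ k @[n --> \oo]
      --> \sum_(0 <= k < K) cabs (f k - f k) * r ^+ k.
    apply: cvg_big => [|k _]; first exact: add_continuous.
    apply: cvgM; last exact: cvg_cst.
    by apply: cvg_cabs; apply: cvgB; [apply: cvg_cst|apply: hf].
  rewrite (eq_bigr (fun=> 0)) ?big1 // in hc; last by move=> k _; rewrite subrr cabs0 mul0r.
  by apply: (cvgr_lt 0 hc); rewrite divr_gt0.
apply: filterS2 hs hB => n hs hn z zr.
have zr2 : 2 * cabs z <= 2 * r by rewrite ler_pM2l.
have h1 := power_series_tail K zr2 hfB.
have h2 := horner_tail K zr2 hn.
have h3 : cabs (\sum_(0 <= k < K) f k * z ^+ k - \sum_(0 <= k < K) (fs n)`_k * z ^+ k)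
    <= \sum_(0 <= k < K) cabs (f k - (fs n)`_k) * r ^+ k.
  rewrite -sumrB; apply: le_trans (cabs_sum _ _ _) _.
  apply: ler_sum => k _; rewrite -mulrBl cabsM cabsX ler_wpM2l ?cabs_ge0 //.
  by rewrite lerXn2r ?nnegrE ?cabs_ge0 // ltW.
set s1 := \sum_(0 <= k < K) f k * _ in h1 h3; set s2 := \sum_(0 <= k < K) _ * z ^+ k in h2 h3.
have -> : fps_fun f z - (fs n).[z] = (fps_fun f z - s1) + (s1 - s2) - ((fs n).[z] - s2).
  by ring.
apply: le_lt_trans (ler_cabsB _ _) _.
apply: le_lt_trans (lerD (ler_cabsD _ _) (lexx _)) _; lra.
Qed.

Lemma cvg_horner fs f z : coef_cvg fs f -> coef_bounded fs ->
  ((fs n).[z] : C) @[n --> \oo] --> fps_fun f z.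
Proof.
move=> hf hb; apply/cvgCP => e e0.
have r0 : 0 < cabs z + 1 by rewrite ltr_wpDl ?cabs_ge0.
apply: filterS (near_disc_horner hf hb r0 e0) => n; apply.
by rewrite lerDl.
Qed.

Lemma coef_bounded_strong fs f : coef_cvg fs f -> coef_bounded fs ->
  cvg_strongly (fun n => horner (fs n)) (fps_fun f).
Proof.
move=> hf hb; apply/fam_cvgP => K cK P /uniform_nbhs[E [entE hE]].
have [e /= e0 he] : exists2 e : R[i], 0 < e & [set xy | ball xy.1 e xy.2] `<=` E.
  by have := entE; rewrite -entourage_ballE => -[e /= e0 he]; exists e.
have er : e = (Re e)%:C%C by apply/esym/RRe_real/gtr0_real.
have e0' : 0 < Re e by rewrite er ltcR in e0.
have [r r0 hr] : exists2 r : R, 0 < r & forall z : C, K z -> cabs z <= r.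
  (* Compact sets are bounded: apply the covering property to the condition [cabs z <= n%:R] as [n]
     grows. *)
  have /compact_near_coveringP nK := cK.
  have := nK nat \oo (fun n z => cabs z <= n%:R) _ _; case.
    move=> x Kx.
    have h1 : \forall z \near x, cabs (x - z) < 1.
      have /cvgCP h0 : (fun z : C => z) z @[z --> (x : C)] --> (x : C) by apply: cvg_id.
      exact: h0 ltr01.
    exists ([set z | cabs (x - z) < 1], [set n | cabs x + 1 <= n%:R]).
      split => //=; have [N hN] : exists N : nat, cabs x + 1 <= N%:R.
        exists (Num.truncn (cabs x + 1)).+1; apply/ltW/truncnS_gt.
      by exists N => // n /= Nn; apply: le_trans hN _; rewrite ler_nat.
    move=> [z n] /= [hz hn]; apply: le_trans hn.
    by have := lerB_cabsD z (- x); rewrite cabsN cabs_distC; lra.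
  move=> N _ hN; exists N.+1%:R; first by rewrite ltr0n.
  by move=> z Kz; apply: (hN N.+1) => //=; apply: leqnSn.
have hn := near_disc_horner hf hb r0 e0'.
apply: filterS hn => n hn; apply: hE => y Ky; apply: he => /=.
rewrite -ball_normE /= normC_cabs er ltcR; apply: hn; exact: hr.
Qed.

Lemma coef_bounded_represents_entire fs f : coef_cvg fs f -> coef_bounded fs ->
  represents_entire f.
Proof.
move=> hf hb; apply/eqyP => A A0; apply: ereal_sup_ubound.
exists (A%:C%C : C); last by rewrite cabs_real gtr0_norm.
have A2 : 0 < 2 * A by rewrite mulr_gt0.
have [B hB] := hb (2 * A) A2.
apply: (@cvg_power_series _ (2 * A) B); first by rewrite cabs_real gtr0_norm.
exact: coef_lim_bounded hf (ltW A2) hB.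
Qed.

Lemma cabs_taylor1_monomial (z h : C) (r : R) k : 1 <= r -> cabs z <= r ->
  cabs (z + h) <= r ->
  cabs ((z + h) ^+ k - z ^+ k - h * (z ^+ k.-1 *+ k)) <= cabs h ^+ 2 * (4 * r) ^+ k.
Proof.
move=> r1 zr zhr; have r0 : 0 <= r by apply: le_trans r1.
elim: k => [|k IH].
  rewrite !expr0 mulr0n mulr0 subrr subr0 cabs0 mulr1 sqr_ge0 //.
(* The remainders satisfy [E_(k+1) = (z + h) E_k + k h^2 z^(k-1)]. The factor [4] in [(4 * r) ^+ k]
   has room for both terms and for [k <= 4^k]. *)
rewrite /= (_ : _ - _ = (z + h) * ((z + h) ^+ k - z ^+ k - h * (z ^+ k.-1 *+ k))
   + h * h * (z ^+ k.-1 *+ k)); last first.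
  case: k {IH} => [|k] /=; first by rewrite !mulr0n !expr1 !expr0; ring.
  rewrite -(mulr_natr (z ^+ k)) -(mulr_natr (z ^+ k.+1)) (natrD _ 1 k.+1) [(z + h) ^+ k.+2]exprS [z ^+ k.+2]exprS.
  rewrite [z ^+ k.+1]exprS; move: ((z + h) ^+ k.+1) (z ^+ k) (k.+1%:R : C) => Y x n.
  by ring.
apply: le_trans (ler_cabsD _ _) _; rewrite !cabsM.
have h0 : 0 <= cabs h ^+ 2 := sqr_ge0 _.
have hk : cabs (z ^+ k.-1 *+ k) <= r * (4 * r) ^+ k.
  rewrite -mulr_natr cabsM cabs_nat cabsX exprMn mulrCA mulrC.
  apply: ler_pM; rewrite ?exprn_ge0 ?cabs_ge0 //.
    by rewrite -natrX ler_nat ltnW // ltn_expl.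
  apply: (@le_trans _ _ (r ^+ k.-1)); first by rewrite lerXn2r ?nnegrE ?cabs_ge0.
  by rewrite -exprS ler_weXn2l //; case: (k) => //= m; rewrite leqW.
rewrite -expr2 [(4 * r) ^+ k.+1]exprS.
have p0 : 0 <= (4 * r) ^+ k by rewrite exprn_ge0 // mulr_ge0.
have h1 : cabs (z + h) * cabs ((z + h) ^+ k - z ^+ k - h * (z ^+ k.-1 *+ k))
   <= r * (cabs h ^+ 2 * (4 * r) ^+ k) by rewrite ler_pM ?cabs_ge0.
have h2 : cabs h ^+ 2 * cabs (z ^+ k.-1 *+ k) <= cabs h ^+ 2 * (r * (4 * r) ^+ k).
  exact: ler_wpM2l.
have h3 : 0 <= cabs h ^+ 2 * (r * (4 * r) ^+ k).
  by apply: mulr_ge0 => //; apply: mulr_ge0.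
lra.
Qed.

(** Sum the monomial estimates: a bound at radius [8 r] leaves the ratio [1 / 2] against
    [(4 * r) ^+ k]. The constant does not depend on [p]. *)
Lemma cabs_taylor1 p (z h : C) (r B : R) : 1 <= r -> cabs z <= r ->
  cabs (z + h) <= r -> (forall k, cabs p`_k * (8 * r) ^+ k <= B) ->
  cabs (p.[z + h] - p.[z] - h * p^`().[z]) <= 2 * B * cabs h ^+ 2.
Proof.
move=> r1 zr zhr hB; have r0 : 0 <= r by apply: le_trans r1.
have B0 : 0 <= B.
  by apply: le_trans (hB 0%N); rewrite expr0 mulr1 cabs_ge0.
have -> : p^`().[z] = \sum_(0 <= k < size p) p`_k * (z ^+ k.-1 *+ k).
  rewrite big_mkord; case hp : (size p) => [|n].
    move/eqP: hp; rewrite size_poly_eq0 => /eqP ->.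
    by rewrite deriv0 horner0 big_ord0.
  rewrite big_ord_recl mulr0n mulr0 add0r (@horner_coef_wide _ n); last first.
    by have := size_poly n (fun i => p`_i.+1 *+ i.+1); rewrite /deriv hp.
  by apply: eq_bigr => i _; rewrite coef_deriv /= mulrnAl mulrnAr.
rewrite !horner_coef !big_mkord mulr_sumr -!sumrB.
apply: le_trans (cabs_sum _ _ _) _.
apply: (@le_trans _ _ (\sum_(i < size p) cabs h ^+ 2 * (cabs p`_i * (4 * r) ^+ i))).
  apply: ler_sum => i _; rewrite mulrCA -!mulrBr cabsM mulrCA.
  by rewrite ler_wpM2l ?cabs_ge0 // cabs_taylor1_monomial.
rewrite -mulr_sumr mulrC ler_wpM2r ?sqr_ge0 //.
rewrite -(big_mkord predT (fun i => cabs p`_i * (4 * r) ^+ i)).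
rewrite -[2 * B]mulr1 -[1 in leRHS](expr0 (1 / 2)).
apply: sum_geometric_tail => // k _.
have -> : cabs p`_k * (4 * r) ^+ k = cabs p`_k * (8 * r) ^+ k * (1 / 2) ^+ k.
  by rewrite -mulrA -exprMn; congr (_ * _ ^+ _); field.
by rewrite ler_wpM2r ?exprn_ge0.
Qed.

(** Doubling the radius absorbs the factor [k + 1 <= 2^(k+1)]. *)
Lemma coef_bounded_deriv fs : coef_bounded fs -> coef_bounded (fun n => (fs n)^`()).
Proof.
move=> hb r r0; have [|B hB] := hb (2 * r); first by rewrite mulr_gt0.
exists (B / r); apply: filterS hB => n hB k.
rewrite ler_pdivlMr // -mulrA -exprSr coef_deriv -mulr_natr cabsM cabs_nat.
apply: le_trans (hB k.+1); rewrite exprMn -mulrA ler_wpM2l ?cabs_ge0 //.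
by rewrite ler_wpM2r ?exprn_ge0 ?(ltW r0) // -natrX ler_nat ltnW // ltn_expl.
Qed.

(** The inequality of [cabs_taylor1], being uniform in [n], survives the limit and shows that
    [fps_fun f] has the limit of the derivatives as its derivative. *)
Lemma coef_bounded_entire fs f : coef_cvg fs f -> coef_bounded fs ->
  entire (fps_fun f).
Proof.
move=> hf hb z.
have hb' := coef_bounded_deriv hb.
pose f' k : C := f k.+1 *+ k.+1.
have hf' : coef_cvg (fun n => (fs n)^`()) f'.
  move=> k; under eq_fun do rewrite coef_deriv.
  by apply: cvgMn; apply: hf.
set r := cabs z + 1; have r1 : 1 <= r by rewrite lerDr cabs_ge0.
have [|B0 hB0] := hb (8 * r); first by rewrite mulr_gt0 // (lt_le_trans _ r1).
pose B := Num.max B0 0.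
have B_ge0 : 0 <= B by rewrite le_max lexx orbT.
have hB : \forall n \near \oo, forall k, cabs ((fs n)`_k) * (8 * r) ^+ k <= B.
  by apply: filterS hB0 => n h k; apply: le_trans (h k) _; rewrite le_max lexx.
have key (h : C) : cabs h <= 1 ->
    cabs (fps_fun f (z + h) - fps_fun f z - h * fps_fun f' z) <= 2 * B * cabs h ^+ 2.
  move=> h1.
  have hc : cabs ((fs n).[z + h] - (fs n).[z] - h * (fs n)^`().[z]) @[n --> \oo] -->
      cabs (fps_fun f (z + h) - fps_fun f z - h * fps_fun f' z).
    apply: cvg_cabs; apply: cvgB; first by apply: cvgB; apply: cvg_horner.
    by apply: cvgM; [apply: cvg_cst|apply: cvg_horner].
  apply: (cvgr_to_le hc); apply: filterS hB => n hB.
  apply: cabs_taylor1 hB => //; first by rewrite lerDl.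
  by apply: le_trans (ler_cabsD _ _) _; rewrite lerD2l.
rewrite /derivable; apply/cvg_ex; exists (fps_fun f' z).
apply/cvgCP => e e0.
have hd (d : R) : 0 < d -> \forall h \near (0 : C)^', cabs h < d.
  move=> d0; have : \forall h \near (0 : C)^', cabs (0 - h) < d.
    have /cvgCP h0 : (fun z : C => z) z @[z --> (0 : C)^'] --> (0 : C).
      exact: cvg_within.
    exact: h0 d0.
  by apply: filterS => h; rewrite sub0r cabsN.
have hn : \forall h \near (0 : C)^', h != 0 by exact: nbhs_dnbhs_neq.
have B1 : 0 < 2 * B + 1 by rewrite ltr_wpDl // mulr_ge0.
apply: filterS3 hn (hd _ ltr01) (hd _ (divr_gt0 e0 B1)) => h hn h1 h2.
have hk := key h (ltW h1).
have h0 : 0 < cabs h by rewrite cabs_gt0.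
rewrite -(ltr_pM2l h0) -cabsM /=.
have -> : h *: (1 : C) + z = z + h by rewrite addrC [h *: _]mulr1.
move: (fps_fun f (z + h)) (fps_fun f z) (fps_fun f' z) hk => F1 F0 L hk.
have -> : h * (L - h^-1 *: (F1 - F0)) = - (F1 - F0 - h * L).
  by rewrite mulrBr [h * (h^-1 *: _)]mulrA divff // mul1r [RHS]opprB.
rewrite cabsN; apply: le_lt_trans hk _.
rewrite mulrC expr2 -mulrA ltr_pM2l //.
rewrite ltr_pdivlMr // in h2; apply: le_lt_trans h2.
by rewrite ler_pM2l // lerDl.
Qed.

End Weak_limits.

(** * Coefficient bounds from the location of the roots *)

Section Coefficient_bounds.
Variable R : realType.
Local Notation C := (Cplx R).
Local Notation Re := (@complex.Re R).
Local Notation Im := (@complex.Im R).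
Implicit Types (fs : nat -> {poly R[i]}) (f : nat -> C) (z : C) (p : {poly R[i]}).

Lemma cvg_weakly_coef fs f : cvg_weakly fs f -> coef_cvg fs f.
Proof.
move=> [hc ->] k; rewrite /weak_limit.
have hk : (fun n => (fs n)`_k : C) = (fun n => (k`!%:R)^-1 * ((fs n)^`(k)).[0] : C).
  apply/funext => n; rewrite horner_coef0 coef_derivn addn0 ffactnn.
  by rewrite -(mulr_natl (fs n)`_k) mulKf // pnatr_eq0 -lt0n fact_gt0.
rewrite hk; apply: cvgM; [exact: cvg_cst|exact: hc].
Qed.

Lemma cvgC_neq0 (u : nat -> C) (l : C) : u n @[n --> \oo] --> l -> l != 0 ->
  \forall n \near \oo, u n != 0.
Proof.
move=> /cvgCP ul l0; rewrite -cabs_gt0 in l0.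
apply: filterS (ul _ l0) => n; apply: contraTneq => ->.
by rewrite subr0 ltxx.
Qed.

Lemma near_uhp_roots fs f k : coef_cvg fs f -> f k != 0 ->
  (forall n, zeros (horner (fs n) : C -> C) `<=` uhp R) ->
  \forall n \near \oo, uhp_roots (fs n).
Proof.
move=> hf fk hz; apply: filterS (cvgC_neq0 (hf k) fk) => n pk.
split; first by apply: contraNneq pk => ->; rewrite coef0.
move=> z /rootP rz; apply: (hz n); split => //.
(* [zeros] asks for a point where [fs n] does not vanish. Without one, Cauchy's estimate with bound
   [0] would annihilate the [k]-th coefficient. *)
apply: contrapT => hno; move: pk; rewrite -cabs_eq0 eq_le cabs_ge0 andbT.
have := @cauchy_estimate R (fs n) 1 0 k ler01; rewrite expr1n mulr1 => -> // w _.
have [->|w0] := eqVneq (fs n).[w] 0; first by rewrite cabs0.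
by case: hno; exists w.
Qed.

(** The power sums of the inverse roots, written with coefficients: they converge with the
    coefficients, even where the single roots do not. *)
Definition inv_root_sum p : C := - (p`_1 / p`_0).
Definition inv_root_sum2 p : C := inv_root_sum p ^+ 2 - 2 * (p`_2 / p`_0).

Lemma inv_root_sumE p s : p`_0 != 0 -> p = p`_0 *: \prod_(w <- s) (1 - w *: 'X) ->
  inv_root_sum p = \sum_(w <- s) w /\ inv_root_sum2 p = \sum_(w <- s) w ^+ 2.
Proof.
move=> p0 hp; have [_ h1 h2] := coef_prod_1BX s.
have hk k : p`_k / p`_0 = (\prod_(w <- s) (1 - w *: 'X))`_k.
  by rewrite {1}hp coefZ mulrAC divff // mul1r.
have e1 : inv_root_sum p = \sum_(w <- s) w by rewrite /inv_root_sum hk h1 opprK.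
by split => //; rewrite /inv_root_sum2 e1 hk -h2 h1 sqrrN.
Qed.

Definition root_bound p : R :=
  Re (inv_root_sum2 p) + 2 * Im (inv_root_sum p) ^+ 2.

Lemma sum_cabs_sqr_root_bound p s : uhp_roots p -> p`_0 != 0 ->
  p = p`_0 *: \prod_(w <- s) (1 - w *: 'X) ->
  (forall w, w \in s -> w != 0 /\ root p w^-1) ->
  (forall w, w \in s -> Im w <= 0) /\ \sum_(w <- s) cabs w ^+ 2 <= root_bound p.
Proof.
move=> [_ hu] p0 hp hs.
have hI w : w \in s -> Im w <= 0.
  by move=> /hs [_ /hu h]; rewrite -[w]invrK; apply: Im_inv_le0.
split => //; rewrite /root_bound; have [-> ->] := inv_root_sumE p0 hp.
exact: sum_cabs_sqr_le.
Qed.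

Section Nonvanishing_constant_term.
Variables (fs : nat -> {poly R[i]}) (f : nat -> C).
Hypotheses (hf : coef_cvg fs f) (f0 : f 0%N != 0).

Lemma cvg_inv_root_sum :
  (inv_root_sum (fs n) : C) @[n --> \oo] --> (- (f 1%N / f 0%N) : C).
Proof.
apply: cvgN; apply: cvgM; first exact: hf.
by apply: cvgV => //; apply: hf.
Qed.

Lemma cvg_inv_root_sum2 : (inv_root_sum2 (fs n) : C) @[n --> \oo] -->
  ((- (f 1%N / f 0%N)) ^+ 2 - 2 * (f 2 / f 0%N) : C).
Proof.
apply: cvgB.
  by rewrite expr2; under eq_fun do rewrite expr2; apply: cvgM; apply: cvg_inv_root_sum.
apply: cvgM; first exact: cvg_cst.
by apply: cvgM; [exact: hf|apply: cvgV => //; apply: hf].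
Qed.

Lemma near_root_bound : exists M : R, \forall n \near \oo, root_bound (fs n) <= M.
Proof.
have hc : root_bound (fs n) @[n --> \oo] -->
   (Re ((- (f 1%N / f 0%N)) ^+ 2 - 2 * (f 2 / f 0%N)) + 2 * Im (- (f 1%N / f 0%N)) ^+ 2).
  apply: cvgD; first exact: cvgC_Re cvg_inv_root_sum2.
  apply: cvgM; first exact: cvg_cst.
  rewrite expr2; under eq_fun do rewrite expr2.
  by apply: cvgM; apply: cvgC_Im cvg_inv_root_sum.
by eexists; apply: (cvgr_le _ hc); exact: ltr_pwDr ltr01 (lexx _).
Qed.

Lemma coef_bounded_of_coef0 :
  (\forall n \near \oo, uhp_roots (fs n)) -> coef_bounded fs.
Proof.
move=> hu r r0.
have [M hM] := near_root_bound.
have hp0 := cvgC_neq0 (@hf 0%N) f0.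
set A := cabs (- (f 1%N / f 0%N)) + 1; set B := cabs (f 0%N) + 1.
have hA : \forall n \near \oo, cabs (inv_root_sum (fs n)) <= A.
  by apply: (cvgr_le _ (cvg_cabs cvg_inv_root_sum)); rewrite ltrDl.
have hB : \forall n \near \oo, cabs (fs n)`_0 <= B.
  have hc : cabs (fs n)`_0 @[n --> \oo] --> cabs (f 0%N) by apply: cvg_cabs; exact: hf.
  by apply: (cvgr_le _ hc); rewrite ltrDl.
exists (B * expR (A * r + M * r ^+ 2 / 2)).
near=> n; move=> k; apply: cauchy_estimate; first exact: ltW.
move=> z zr.
have p0 : (fs n)`_0 != 0 by near: n; exact: hp0.
have un : uhp_roots (fs n) by near: n.
have [s [hp _ hs]] := poly_roots_inverse p0.
have [hI hsM] := sum_cabs_sqr_root_bound un p0 hp hs.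
have [e1 _] := inv_root_sumE p0 hp.
have -> : (fs n).[z] = (fs n)`_0 * \prod_(w <- s) (1 - w * z).
  rewrite {1}hp hornerZ horner_prod; congr (_ * _).
  by apply: eq_bigr => w _; rewrite !hornerE.
have hM' : \sum_(w <- s) cabs w ^+ 2 <= M.
  by apply: le_trans hsM _; near: n.
rewrite cabsM; apply: ler_pM; rewrite ?cabs_ge0 //.
  by near: n.
apply: le_trans (cabs_prod_1BX z hM') _.
rewrite ler_expR zr lerD2r ler_wpM2r ?(ltW r0) // -e1.
by near: n.
Unshelve. all: by end_near.
Qed.

End Nonvanishing_constant_term.

(** From index [m] on, a coefficient is multiplied by an integer at least [1] in the [m]-th
    derivative, hence dominated; the finitely many lower ones converge. *)
Lemma coef_bounded_of_derivn fs f m : coef_cvg fs f ->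
  coef_bounded (fun n => (fs n)^`(m)) -> coef_bounded fs.
Proof.
move=> hf hb r r0; have [B hB] := hb r r0.
have hlow : \forall n \near \oo, forall k, (k < m)%N ->
    cabs ((fs n)`_k) <= \sum_(j < m) (cabs (f j) + 1).
  have h (k : 'I_m) : \forall n \near \oo, cabs ((fs n)`_k) <= cabs (f k) + 1.
    have hc : cabs (fs n)`_k @[n --> \oo] --> cabs (f k) by apply: cvg_cabs; exact: hf.
    by apply: (cvgr_le _ hc); rewrite ltrDl.
  have hall : \forall n \near \oo, forall k : 'I_m, cabs (fs n)`_k <= cabs (f k) + 1.
    exact: filter_forall.
  apply: filterS hall => n hn k km.
  apply: le_trans (hn (Ordinal km)) _; rewrite (bigD1 (Ordinal km)) //= lerDl.
  by apply: sumr_ge0 => j _; rewrite addr_ge0 ?cabs_ge0.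
set D := \sum_(j < m) _ in hlow.
have D0 : 0 <= D by apply: sumr_ge0 => j _; rewrite addr_ge0 ?cabs_ge0.
exists (`|B| * r ^+ m + D * \sum_(j < m) r ^+ j).
have S0 : 0 <= \sum_(j < m) r ^+ j.
  by apply: sumr_ge0 => j _; rewrite exprn_ge0 // ltW.
apply: filterS2 hB hlow => n hB hlow k.
case: (ltnP k m) => km.
  apply: (@le_trans _ _ (D * r ^+ k)); first by rewrite ler_wpM2r ?exprn_ge0 ?(ltW r0) ?hlow.
  apply: (@le_trans _ _ (D * \sum_(j < m) r ^+ j)).
    rewrite ler_wpM2l // (bigD1 (Ordinal km)) //= lerDl.
    by apply: sumr_ge0 => j _; rewrite exprn_ge0 // ltW.
  by rewrite lerDr mulr_ge0 // exprn_ge0 // ltW.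
apply: (@le_trans _ _ (`|B| * r ^+ m)); last by rewrite lerDl mulr_ge0.
have -> : k = (k - m + m)%N by rewrite subnK.
move: (k - m)%N => j.
rewrite exprD mulrA ler_wpM2r ?exprn_ge0 ?(ltW r0) //.
apply: le_trans (ler_norm _); apply: le_trans (hB j).
rewrite ler_wpM2r ?exprn_ge0 ?(ltW r0) // coef_derivn addnC.
rewrite -(mulr_natr (fs n)`_(m + j)) cabsM cabs_nat ler_peMr ?cabs_ge0 // ler1n.
by rewrite ffact_gt0 leq_addr.
Qed.

Lemma coef_bounded_of_uhp fs f m : coef_cvg fs f -> f m != 0 ->
  (\forall n \near \oo, uhp_roots (fs n)) -> coef_bounded fs.
Proof.
move=> hf fm hu; apply: (coef_bounded_of_derivn (m := m) hf).
pose g k : C := f (m + k)%N *+ (m + k) ^_ m.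
have hg : coef_cvg (fun n => (fs n)^`(m)) g.
  by move=> k; under eq_fun do rewrite coef_derivn; apply: cvgMn; apply: hf.
have g0 : g 0%N != 0.
  by rewrite /g addn0 ffactnn -(mulr_natr (f m)) mulf_neq0 // pnatr_eq0 -lt0n fact_gt0.
apply: (coef_bounded_of_coef0 hg g0).
apply: filterS2 hu (cvgC_neq0 (hg 0%N) g0) => n un gn.
by apply: uhp_roots_derivn => //; apply: contraNneq gn => ->; rewrite coef0.
Qed.

End Coefficient_bounds.

(** * Roots tending to zero and their division *)

Section Roots_tending_to_zero.
Variable R : realType.
Local Notation C := (Cplx R).
Local Notation Re := (@complex.Re R).
Local Notation Im := (@complex.Im R).
Implicit Types (fs : nat -> {poly R[i]}) (f : nat -> C) (z : C) (p q : {poly R[i]}).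

Lemma seq_argmin (T : eqType) (g : T -> R) (s : seq T) : s != [::] ->
  exists2 x, x \in s & forall y, y \in s -> g x <= g y.
Proof.
elim: s => // a [|b s] IH _.
  by exists a; rewrite ?mem_head // => y; rewrite inE => /eqP ->.
have [//|x xs hx] := IH; have [ax|xa] := lerP (g a) (g x).
  exists a; rewrite ?mem_head // => y; rewrite inE => /orP[/eqP -> //|ys].
  exact: le_trans (hx _ ys).
exists x; first by rewrite inE xs orbT.
by move=> y; rewrite inE => /orP[/eqP ->|ys]; [exact: ltW|exact: hx].
Qed.

Lemma min_modulus_root p z : p != 0 -> root p z ->
  exists2 x, root p x & forall y, root p y -> cabs x <= cabs y.
Proof.
move=> p0 rz; have [s hs] := closed_field_poly_normal p.
have hr x : root p x = (x \in s).
  by rewrite hs rootZ ?lead_coef_eq0 // root_prod_XsubC.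
have s0 : s != [::] by apply: contraTneq rz => s0; rewrite hr s0.
have [x xs hx] := seq_argmin (fun x : C => cabs x) s0.
by exists x; rewrite ?hr // => y; rewrite hr; apply: hx.
Qed.

Lemma exists_small_root p (r e d : R) : 0 <= r -> r <= e -> 0 <= d ->
  (forall z, cabs z = r -> d <= cabs p.[z]) -> 2 * cabs p`_0 < d ->
  exists2 z, root p z & cabs z < e.
Proof.
move=> r0 re d0 hd pd; apply: contrapT => hno.
have [p0|p0] := eqVneq p`_0 0.
  apply: hno; exists 0; first by rewrite /root horner_coef0 p0.
  rewrite cabs0 lt_neqAle (le_trans r0 re) andbT; apply: contraTneq pd => e0.
  have r00 : r = 0 by apply/eqP; rewrite eq_le r0 e0 re.
  have := hd 0; rewrite cabs0 r00 horner_coef0 p0 cabs0 mulr0 => /(_ erefl).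
  by rewrite leNgt.
have [s [hp _ hs]] := poly_roots_inverse p0.
suff : d <= 2 * cabs p`_0 by rewrite leNgt pd.
apply: (minimum_modulus hp r0 d0 _ hd) => w ws.
have [w0 rw] := hs w ws.
have ew : e <= cabs w^-1 by rewrite leNgt; apply/negP => h; apply: hno; exists w^-1.
rewrite cabsV in ew; rewrite -[leRHS](@divff _ (cabs w)) ?cabs_eq0 //.
by rewrite ler_wpM2l ?cabs_ge0 // (le_trans re).
Qed.

Lemma fps_fun_lower_bound f m (B e : R) : (forall k, (k < m)%N -> f k = 0) ->
  f m != 0 -> (forall k, cabs (f k) * 2 ^+ k <= B) -> 0 < e ->
  exists r d : R, [/\ 0 < r, r <= e, 0 < d &
    forall z, cabs z = r -> d <= cabs (fps_fun f z)].
Proof.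
move=> flow fm hB e0.
have B0 : 0 <= B by apply: le_trans (hB 0%N); rewrite mulr_ge0 ?cabs_ge0.
have fm0 : 0 < cabs (f m) by rewrite cabs_gt0.
have B1 : 0 < 4 * B + 1 by rewrite ltr_wpDl // mulr_ge0.
(* [1 / 2] keeps the disc within half of the radius [2] where [B] is known; the last term makes the
   remainder [2 B r^(m+1)] at most half of the leading term [|f m| r^m]. *)
pose r := Num.min (Num.min e (1 / 2)) (cabs (f m) / (4 * B + 1)).
have r0 : 0 < r by rewrite !lt_min e0 divr_gt0 //= divr_gt0.
have re : r <= e by rewrite !ge_min lexx.
have r2 : r <= 1 / 2 by rewrite !ge_min lexx !orbT.
have rB : r * (4 * B + 1) <= cabs (f m).
  by rewrite -ler_pdivlMr // !ge_min lexx !orbT.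
exists r, (cabs (f m) * r ^+ m / 2); split => //.
  by rewrite divr_gt0 // mulr_gt0 // exprn_gt0.
move=> z zr.
have hcv : cvgn (power_series f z).
  by apply: (cvg_power_series _ hB); rewrite zr; lra.
have hterm k : (m.+1 <= k)%N ->
    cabs (f k * z ^+ k) <= B * (2 * r) ^+ m.+1 * (1 / 2) ^+ k.
  move=> mk; rewrite cabsM cabsX zr.
  have -> : r ^+ k = (2 * r) ^+ k * (1 / 2) ^+ k.
    by rewrite -exprMn; congr (_ ^+ _); field.
  rewrite mulrA ler_wpM2r ?exprn_ge0 //; apply: ler_pM; rewrite ?cabs_ge0 //.
  - by rewrite exprn_ge0 // mulr_ge0 // ltW.
  - apply: le_trans (hB k); rewrite ler_peMr ?cabs_ge0 //.
    by apply: exprn_ege1; rewrite ler1n.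
  - rewrite -(subnK mk) exprD ler_piMl ?exprn_ge0 ?mulr_ge0 ?(ltW r0) //.
    by rewrite exprn_ile1 ?mulr_ge0 ?(ltW r0) //; lra.
have hBr : 0 <= B * (2 * r) ^+ m.+1.
  by rewrite mulr_ge0 // exprn_ge0 // mulr_ge0 // ltW.
have := power_series_tail_gen hcv hBr hterm.
have -> : \sum_(0 <= k < m.+1) f k * z ^+ k = f m * z ^+ m.
  rewrite big_nat_recr //= big1_seq ?add0r // => k.
  by rewrite mem_index_iota => /andP[_ /andP[_ km]]; rewrite flow // mul0r.
have -> : 2 * (B * (2 * r) ^+ m.+1) * (1 / 2) ^+ m.+1 = 2 * B * r * r ^+ m.
  rewrite -mulrA -mulrA -exprMn (_ : 2 * r * (1 / 2) = r); last by field.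
  by rewrite exprS !mulrA.
move=> h1.
have h2 := lerB_cabsD (f m * z ^+ m) (fps_fun f z - f m * z ^+ m).
rewrite [X in _ <= cabs X]addrC subrK in h2.
rewrite cabsM cabsX zr in h2.
have h3 : r * (4 * B + 1) * r ^+ m <= cabs (f m) * r ^+ m.
  by rewrite ler_wpM2r // exprn_ge0 // ltW.
have h4 : 0 <= r * r ^+ m by rewrite mulr_ge0 ?exprn_ge0 ?(ltW r0).
lra.
Qed.

Lemma near_small_root fs f m (e : R) : coef_cvg fs f -> coef_bounded fs ->
  f 0%N = 0 -> f m != 0 -> 0 < e ->
  \forall n \near \oo, exists2 z, root (fs n) z & cabs z < e.
Proof.
move=> hf hb f0 fm e0.
have [k fk hk] : exists2 k, f k != 0 & forall j, (j < k)%N -> f j = 0.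
  have ex : exists k, f k != 0 by exists m.
  exists (ex_minn ex); case: ex_minnP => // k _ hk j jk.
  by apply/eqP/negPn/negP => /hk; rewrite leqNgt jk.
have [B hB] := hb 2 (ltr0n _ 2).
have hfB := coef_lim_bounded hf (ler0n _ 2) hB.
have [r [d [r0 re d0 hd]]] := fps_fun_lower_bound hk fk hfB e0.
have d4 : 0 < d / 4 by rewrite divr_gt0.
have h0 : \forall n \near \oo, cabs (fs n)`_0 < d / 4.
  have hc : cabs (fs n)`_0 @[n --> \oo] --> cabs (f 0%N) by apply: cvg_cabs; exact: hf.
  by apply: (cvgr_lt _ hc); rewrite f0 cabs0.
apply: filterS2 h0 (near_disc_horner hf hb r0 d4) => n h0 hn.
(* On the circle [|f| >= d] and [|f - f_n| < d / 4], while at the centre [2 |f_n| < d / 2]. *)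
apply: (@exists_small_root _ r e (3 / 4 * d)) => //; [exact: ltW|by rewrite mulr_ge0 // ltW| |lra].
move=> z zr; have := hd z zr; have := hn z; rewrite zr => /(_ (lexx _)).
by have := ler_cabsD (fps_fun f z - (fs n).[z]) (fs n).[z]; rewrite subrK; lra.
Qed.

(** Picking a root of least modulus for each [n] gives a single sequence that works for every
    [e]. *)
Lemma exists_root_sequence fs f m : coef_cvg fs f -> coef_bounded fs ->
  (\forall n \near \oo, fs n != 0) -> f 0%N = 0 -> f m != 0 ->
  exists r : nat -> C, (\forall n \near \oo, root (fs n) (r n)) /\
    cabs (r n) @[n --> \oo] --> (0 : R).
Proof.
move=> hf hb hn0 f0 fm.
pose P n x := root (fs n) x /\ forall y, root (fs n) y -> cabs x <= cabs y.
have hch n : exists x : C, (exists y, P n y) -> P n x.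
  by have [[x hx]|hno] := pselect (exists x, P n x); [exists x|exists 0].
have [r hr] := choice hch.
have hP e : 0 < e -> \forall n \near \oo, root (fs n) (r n) /\ cabs (r n) < e.
  move=> e0; apply: filterS2 hn0 (near_small_root hf hb f0 fm e0) => n n0 [z rz ze].
  have [x rx hx] := min_modulus_root n0 rz.
  have [h1 h2] := hr n (ex_intro _ x (conj rx hx)).
  by split => //; apply: le_lt_trans (h2 _ rz) ze.
exists r; split.
  by apply: filterS (hP 1 ltr01) => n [].
apply/cvgrPdist_lt => e e0; apply: filterS (hP e e0) => n [_].
by rewrite sub0r normrN ger0_norm ?cabs_ge0.
Qed.

(** Descend from the top coefficient along [q_k = p_(k+1) + a q_(k+1)]. As [|a| <= r / 2], the bound
    [2 B] reproduces itself: [B + (1 / 2) * 2 B = 2 B]. *)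
Lemma coef_div_bound p q (a : C) (r B : R) : 0 < r -> 2 * cabs a <= r ->
  p = q * ('X - a%:P) -> (forall k, cabs p`_k * r ^+ k <= B) ->
  forall k, cabs q`_k * r ^+ k <= 2 * B / r.
Proof.
move=> r0 ar hp hB k; rewrite ler_pdivlMr // -mulrA -exprSr.
have B0 : 0 <= B by apply: le_trans (hB 0%N); rewrite expr0 mulr1 cabs_ge0.
have hq j : q`_j = p`_j.+1 + a * q`_j.+1.
  by rewrite hp mulrBr coefB coefMX coefMC /=; ring.
have [n hn] : exists n, (size q <= k + n)%N by exists (size q); apply: leq_addl.
elim: n k hn => [|n IH] k hn.
  by rewrite addn0 in hn; rewrite nth_default // cabs0 mul0r mulr_ge0.
have h1 := IH k.+1; rewrite addSnnS in h1; have {}h1 := h1 hn.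
rewrite hq; have h2 := hB k.+1.
have r1 : 0 <= r ^+ k.+1 by rewrite exprn_ge0 // ltW.
have h3 : cabs (p`_k.+1 + a * q`_k.+1) * r ^+ k.+1 <=
   cabs p`_k.+1 * r ^+ k.+1 + cabs a * (cabs q`_k.+1 * r ^+ k.+1).
  by rewrite mulrA -mulrDl ler_wpM2r // -cabsM ler_cabsD.
have h4 : cabs a * (cabs q`_k.+1 * r ^+ k.+1) <= r / 2 * (cabs q`_k.+1 * r ^+ k.+1).
  by rewrite ler_wpM2r ?mulr_ge0 ?cabs_ge0 //; lra.
rewrite [r ^+ k.+2]exprS in h1; lra.
Qed.

(** [fs n] need not vanish at [0], so it is divided by ['X - r_n] with a root [r_n] tending to [0];
    in the limit this is division by ['X], a shift of the coefficients. *)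
Lemma divide_small_root fs f m : coef_cvg fs f -> coef_bounded fs ->
  (\forall n \near \oo, uhp_roots (fs n)) -> f 0%N = 0 -> f m != 0 ->
  exists gs : nat -> {poly R[i]},
    [/\ coef_cvg gs (fun k => f k.+1), coef_bounded gs,
        \forall n \near \oo, uhp_roots (gs n) &
        forall z, fps_fun f z = z * fps_fun (fun k => f k.+1) z].
Proof.
move=> hf hb hu f0 fm.
have hn0 : \forall n \near \oo, fs n != 0 by apply: filterS hu => n [].
have [r [hr r0]] := exists_root_sequence hf hb hn0 f0 fm.
pose gs n := fs n %/ ('X - (r n)%:P).
have hg : \forall n \near \oo, fs n = gs n * ('X - (r n)%:P).
  by apply: filterS hr => n rn; rewrite /gs divpK // dvdp_XsubCl.
have gb : coef_bounded gs.
  move=> e e0; have [B hB] := hb e e0; exists (2 * B / e).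
  have re : \forall n \near \oo, cabs (r n) < e / 2.
    by apply: (cvgr_lt _ r0); rewrite divr_gt0.
  apply: filterS3 hg re hB => n hn re hB; apply: (coef_div_bound e0 _ hn hB).
  by lra.
have gc : coef_cvg gs (fun k => f k.+1).
  move=> k; have [B hB] := gb 1 ltr01.
  have hc : cabs (f k.+1 - (fs n)`_k.+1) + cabs (r n) * `|B| @[n --> \oo] --> (0 : R).
    rewrite -[X in _ --> X](addr0) -[X in _ --> _ + X](mul0r `|B|).
    apply: cvgD; last by apply: cvgM => //; apply: cvg_cst.
    have hd : cabs (f k.+1 - (fs n)`_k.+1) @[n --> \oo] --> cabs (f k.+1 - f k.+1).
      by apply: cvg_cabs; apply: cvgB; [apply: cvg_cst|apply: hf].
    by rewrite subrr cabs0 in hd.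
  apply/cvgCP => e e0.
  apply: filterS3 hg hB (cvgr_lt _ hc _ e0) => n hn hB; apply: le_lt_trans.
  have -> : f k.+1 - (gs n)`_k = (f k.+1 - (fs n)`_k.+1) - r n * (gs n)`_k.+1.
    by rewrite [in RHS]hn mulrBr coefB coefMX coefMC /=; ring.
  apply: le_trans (ler_cabsB _ _) _; rewrite lerD2l cabsM ler_wpM2l ?cabs_ge0 //.
  by apply: le_trans (ler_norm B); have := hB k.+1; rewrite expr1n mulr1.
exists gs; split => //.
  apply: filterS2 hu hg => n [n0 un] hn; split.
    by apply: contraNneq n0 => g0; rewrite hn g0 mul0r.
  by move=> z rz; apply: un; rewrite hn rootM rz.
move=> z.
have h1 := @cvg_horner _ _ _ z hf hb; have h2 := @cvg_horner _ _ _ z gc gb.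
have h3 : (z - r n) * (gs n).[z] @[n --> \oo] --> z * fps_fun (fun k => f k.+1) z.
  apply: cvgM; last exact: h2.
  apply/cvgCP => e e0; apply: filterS (cvgr_lt _ r0 _ e0) => n.
  by rewrite opprB addrC subrK.
have h4 : ((fs n).[z] : C) @[n --> \oo] --> z * fps_fun (fun k => f k.+1) z.
  apply: cvg_trans h3; apply: near_eq_cvg; apply: filterS hg => n hn.
  by rewrite [in RHS]hn hornerM hornerXsubC mulrC.
exact: (norm_cvg_unique h1 h4).
Qed.

End Roots_tending_to_zero.

(** * Ultrafilter limits and tails of sorted inverse roots *)

Section Product_limit.
Variable R : realType.
Local Notation C := (Cplx R).
Local Notation Re := (@complex.Re R).
Local Notation Im := (@complex.Im R).
Implicit Types (fs : nat -> {poly R[i]}) (f : nat -> C) (z w : C) (s : seq C).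

Lemma ultra_bounded_cvg (T : Type) (U : set_system T) (u : T -> R) (A : R) :
  UltraFilter U -> (\forall x \near U, `|u x| <= A) ->
  exists l : R, u x @[x --> U] --> l.
Proof.
move=> UU hA; have PU := @ultra_proper _ _ UU.
have [|l [_ hl]] := @segment_compact R (- A) A (u @ U) _.
  by apply: filterS hA => x; rewrite /= in_itv /= ler_norml.
exists l; apply/cvgrPdist_lt => e e0.
(* A cluster point of an ultrafilter is a limit: otherwise the complement of the ball would belong
   to it and miss the ball. *)
have [//|h] := in_ultra_setVsetC [set x | `|l - u x| < e] UU.
have [|y [/= h1 h2]] := hl [set y | ~ `|l - y| < e] [set y | `|l - y| < e] h.
  by apply/nbhs_ballP; exists e => // y.
by case: h1.
Qed.

Lemma ultra_bounded_cvgC (T : Type) (U : set_system T) (u : T -> C) (A : R) :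
  UltraFilter U -> (\forall x \near U, cabs (u x) <= A) ->
  exists l : C, u x @[x --> U] --> l.
Proof.
move=> UU hA; have PU := @ultra_proper _ _ UU.
have [x hx] : exists l : R, Re (u x) @[x --> U] --> l.
  apply: (ultra_bounded_cvg (A := A)).
  by apply: filterS hA => y; apply: le_trans; apply: ler_Re_cabs.
have [y hy] : exists l : R, Im (u x) @[x --> U] --> l.
  apply: (ultra_bounded_cvg (A := A)).
  by apply: filterS hA => t; apply: le_trans; apply: ler_Im_cabs.
by exists (x +i* y)%C; apply: cvgC_ReIm.
Qed.

(** Beyond the end of [s] the default [x0] contributes nothing, so lists of different lengths share
    the index range [j < J]. *)
Lemma big_take_nth (V T : Type) (idx : V) (op : Monoid.law idx) (g : T -> V) (x0 : T)
    (s : seq T) J : g x0 = idx ->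
  \big[op/idx]_(w <- take J s) g w = \big[op/idx]_(j < J) g (nth x0 s j).
Proof.
move=> g0; elim: s J => [|w s IH] J.
  by rewrite /= big_nil big1 // => j _; rewrite nth_nil.
by case: J => [|J]; rewrite ?big_ord0 ?big_nil //= big_cons big_ord_recl IH.
Qed.

(** At least [J] entries precede [w] and are no smaller, so [J |w|^2 <= M]. *)
Lemma sorted_tail_le s J (M e : R) w : sorted (fun v w => cabs w <= cabs v) s ->
  \sum_(v <- s) cabs v ^+ 2 <= M -> (0 < J)%N -> 0 < e -> M <= e ^+ 2 * J%:R ->
  w \in drop J s -> cabs w <= e.
Proof.
move=> ss hM J0 e0 MJ wd.
have tr : transitive (fun v w : C => cabs w <= cabs v).
  by move=> x y z h1 h2; apply: le_trans h2 h1.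
have := ss; rewrite (sorted_pairwise tr) -{1}(cat_take_drop J s) pairwise_cat.
move=> /andP[/allrelP hr _].
have Js : (J < size s)%N by rewrite -subn_gt0 -size_drop; case: (drop J s) wd.
have st : size (take J s) = J by rewrite size_takel // ltnW.
have h1 : cabs w ^+ 2 * J%:R <= M.
  apply: le_trans hM; rewrite -{1}(cat_take_drop J s) big_cat /=.
  apply: (@le_trans _ _ (\sum_(v <- take J s) cabs v ^+ 2)); last first.
    by rewrite lerDl; apply: sumr_ge0 => v _; apply: sqr_ge0.
  apply: (@le_trans _ _ (\sum_(v <- take J s) cabs w ^+ 2)).
    by rewrite big_const_seq count_predT st iter_addr_0 mulr_natr.
  rewrite !big_seq; apply: ler_sum => v vt.
  by rewrite lerXn2r ?nnegrE ?cabs_ge0 // hr.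
rewrite -(@ler_pXn2r _ 2) ?nnegrE ?cabs_ge0 ?(ltW e0) //.
by rewrite -(@ler_pM2r _ J%:R) ?ltr0n // (le_trans h1).
Qed.

(** Keep the first [J] primary factors and replace the others, where [|w| <= e], by their Gaussian.
    The bound depends on [s] only through [\sum w], hence converges with [n]. *)
Lemma prod_1B_approx s z J (M e : R) : sorted (fun v w => cabs w <= cabs v) s ->
  \sum_(v <- s) cabs v ^+ 2 <= M -> (0 < J)%N -> 0 < e -> M <= e ^+ 2 * J%:R ->
  e * cabs z <= 1 ->
  cabs (\prod_(w <- s) (1 - w * z) -
    cexp (- ((\sum_(w <- s) w) * z)) * \prod_(j < J) primary_factor (nth 0 s j * z) *
    cexp (- (z ^+ 2 / 2 * (\sum_(w <- s) w ^+ 2 - \sum_(j < J) nth 0 s j ^+ 2)))) <=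
  expR (cabs (\sum_(w <- s) w) * cabs z) * expR (M * cabs z ^+ 2 / 2) *
  (24 * e * M * cabs z ^+ 3 * expR (M * cabs z ^+ 2 / 2)).
Proof.
move=> ss hM J0 e0 MJ ez.
rewrite prod_1B_primary_factor.
have pf0 : primary_factor ((0 : C) * z) = 1.
  by rewrite /primary_factor mul0r subr0 mul1r cexp0.
rewrite -(@big_take_nth _ _ _ _ (fun w => primary_factor (w * z)) 0 s J pf0).
rewrite -(@big_take_nth _ _ _ _ (fun w : C => w ^+ 2) 0 s J (expr0n _ 2)).
have hsplit (V : Type) (idx : V) (op : Monoid.law idx) (g : C -> V) :
    \big[op/idx]_(w <- s) g w =
    op (\big[op/idx]_(w <- take J s) g w) (\big[op/idx]_(w <- drop J s) g w).
  by rewrite -big_cat cat_take_drop.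
rewrite (hsplit _ _ _ (fun w => primary_factor (w * z))).
rewrite (hsplit _ _ _ (fun w : C => w ^+ 2)) /= [\sum_(w <- take J s) _ + _]addrC addrK.
rewrite mulrA -mulrBr cabsM.
have hM1 : \sum_(v <- take J s) cabs v ^+ 2 <= M /\ \sum_(v <- drop J s) cabs v ^+ 2 <= M.
  rewrite (hsplit _ _ _ (fun w : C => cabs w ^+ 2)) /= in hM.
  have h1 : 0 <= \sum_(v <- take J s) cabs v ^+ 2 by apply: sumr_ge0 => v _; apply: sqr_ge0.
  have h2 : 0 <= \sum_(v <- drop J s) cabs v ^+ 2 by apply: sumr_ge0 => v _; apply: sqr_ge0.
  by split; lra.
have [hM1t hM1d] := hM1.
apply: ler_pM; rewrite ?cabs_ge0 //; last first.
  apply: prod_primary_factor_approx => //; first exact: ltW.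
  by move=> w; apply: sorted_tail_le ss hM J0 e0 MJ.
rewrite cabsM; apply: ler_pM; rewrite ?cabs_ge0 //.
  by rewrite -cabsM -(cabsN (_ * z)) cabs_cexp_le.
exact: cabs_prod_primary_factor.
Qed.

(** Both [Im (w^2) = 2 Re w Im w] and [- Re (w^2) <= (Im w)^2] have a factor [Im w], whose sum is
    controlled; the other factor is at most [e]. *)
Lemma sum_sqr_near_nneg s (e : R) : (forall w, w \in s -> Im w <= 0 /\ cabs w <= e) ->
  `|Im (\sum_(w <- s) w ^+ 2)| <= 2 * e * \sum_(w <- s) - Im w /\
  - Re (\sum_(w <- s) w ^+ 2) <= e * \sum_(w <- s) - Im w.
Proof.
move=> hs; split.
  rewrite raddf_sum /= mulr_sumr; apply: le_trans (ler_norm_sum _ _ _) _.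
  rewrite !big_seq; apply: ler_sum => w /hs[h1 h2].
  have h3 := le_trans (ler_Re_cabs w) h2.
  rewrite expr2 Im_M; move: h3; rewrite !ler_norml => /andP[h3 h4].
  by apply/andP; split; nra.
rewrite raddf_sum /= -sumrN mulr_sumr.
rewrite !big_seq; apply: ler_sum => w /hs[h1 h2].
have h3 := le_trans (ler_Im_cabs w) h2.
rewrite expr2 Re_M; move: h3; rewrite ler_norml => /andP[h3 h4]; nra.
Qed.

Lemma sum_sqr_tail_near_nneg s J (M e : R) :
  sorted (fun v w => cabs w <= cabs v) s -> \sum_(v <- s) cabs v ^+ 2 <= M ->
  (forall w, w \in s -> Im w <= 0) ->
  (0 < J)%N -> 0 < e -> M <= e ^+ 2 * J%:R ->
  let T := \sum_(w <- s) w ^+ 2 - \sum_(j < J) nth 0 s j ^+ 2 in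
  `|Im T| <= 2 * e * - Im (\sum_(w <- s) w) /\ - Re T <= e * - Im (\sum_(w <- s) w).
Proof.
move=> ss hM hI J0 e0 MJ /=.
rewrite -(@big_take_nth _ _ _ _ (fun w : C => w ^+ 2) 0 s J (expr0n _ 2)).
rewrite -{1 4}(cat_take_drop J s) !big_cat /= [X in X - _]addrC addrK.
have hd w : w \in drop J s -> Im w <= 0 /\ cabs w <= e.
  move=> wd; split; first exact: hI (mem_drop wd).
  exact: sorted_tail_le ss hM J0 e0 MJ wd.
have [h1 h2] := sum_sqr_near_nneg hd.
have h3 : \sum_(w <- drop J s) - Im w <= - Im (\sum_(w <- s) w).
  rewrite raddf_sum /= -sumrN -{2}(cat_take_drop J s) big_cat /= lerDr.
  by rewrite big_seq; apply: sumr_ge0 => w /mem_take /hI; rewrite oppr_ge0.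
split; [apply: le_trans h1 _|apply: le_trans h2 _].
  by apply: ler_wpM2l => //; rewrite mulr_ge0 // ltW.
by apply: ler_wpM2l => //; apply: ltW.
Qed.

Lemma cvg_sum_of_bounded_cabs (u : nat -> C) (M : R) :
  (forall J, \sum_(j < J) cabs (u j) <= M) ->
  exists l : C, \sum_(j < J) u j @[J --> \oo] --> l.
Proof.
move=> hM.
have habs : cvgn (series (fun j => cabs (u j))).
  apply: nondecreasing_is_cvgn.
    by apply: nondecreasing_series => j _ _; apply: cabs_ge0.
  by exists M => _ [J _ <-]; rewrite /series /= big_mkord.
have hc (g : C -> R) : (forall w, `|g w| <= cabs w) ->
    cvgn (series (fun j => g (u j))).
  move=> hg; apply: normed_cvg; apply: series_le_cvg habs => j //=.
  exact: cabs_ge0.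
have /cvg_ex[/= x hx] := hc Re (@ler_Re_cabs R).
have /cvg_ex[/= y hy] := hc Im (@ler_Im_cabs R).
exists (x +i* y)%C; apply: cvgC_ReIm => /=.
  by under eq_fun do rewrite raddf_sum /= -(big_mkord predT (fun j => Re (u j))).
by under eq_fun do rewrite raddf_sum /= -(big_mkord predT (fun j => Im (u j))).
Qed.

Lemma le0_of_le_small (x c : R) : 0 <= c -> (forall e, 0 < e -> x <= e * c) -> x <= 0.
Proof.
move=> c0 h; rewrite leNgt; apply/negP => x0.
have c1 : 0 < c + 1 by rewrite ltr_wpDl.
have := h (x / (c + 1)) (divr_gt0 x0 c1); rewrite leNgt mulrAC ltr_pdivrMr //.
by rewrite ltr_pM2l // ltrDl ltr01.
Qed.

End Product_limit.

(** * The product formula when the constant term does not vanish *)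

Section Product_representation.
Variable R : realType.
Local Notation C := (Cplx R).
Local Notation Re := (@complex.Re R).
Local Notation Im := (@complex.Im R).
Variables (fs : nat -> {poly R[i]}) (f : nat -> C).
Hypotheses (hf : coef_cvg fs f) (f0 : f 0%N != 0).
Hypothesis hu : \forall n \near \oo, uhp_roots (fs n).

Let sorted_cabs := sorted (fun v w : C => cabs w <= cabs v).

Lemma exists_inverse_roots : exists (s : nat -> seq C) (M : R),
  \forall n \near \oo, [/\ fs n = (fs n)`_0 *: \prod_(w <- s n) (1 - w *: 'X),
    sorted_cabs (s n), (forall w, w \in s n -> Im w <= 0),
    \sum_(w <- s n) cabs w ^+ 2 <= M &
    inv_root_sum (fs n) = \sum_(w <- s n) w /\
    inv_root_sum2 (fs n) = \sum_(w <- s n) w ^+ 2].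
Proof.
have [M hM] := near_root_bound hf f0.
have hp0 := cvgC_neq0 (@hf 0%N) f0.
pose P n (s : seq C) := [/\ fs n = (fs n)`_0 *: \prod_(w <- s) (1 - w *: 'X),
    sorted_cabs s, (forall w, w \in s -> Im w <= 0),
    \sum_(w <- s) cabs w ^+ 2 <= root_bound (fs n) &
    inv_root_sum (fs n) = \sum_(w <- s) w /\
    inv_root_sum2 (fs n) = \sum_(w <- s) w ^+ 2].
have hch n : exists s : seq C, uhp_roots (fs n) -> (fs n)`_0 != 0 -> P n s.
  have [p0|p0] := eqVneq (fs n)`_0 0; first by exists [::].
  have [s [hp ss hs]] := poly_roots_inverse p0.
  exists s => un _; have [h1 h2] := sum_cabs_sqr_root_bound un p0 hp hs.
  by split => //; apply: inv_root_sumE.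
have [s hs] := choice hch.
exists s, M; apply: filterS3 hu hM hp0 => n un hMn p0.
by have [h1 h2 h3 h4 h5] := hs n un p0; split => //; apply: le_trans h4 hMn.
Qed.

(** The sequence [om] is infinite in all cases, a zero entry contributing the factor [1]. The
    exponential part stands in the denominator because the partial products themselves have to
    converge. *)
Lemma product_representation : exists (om : nat -> C) (M alpha : R),
  [/\ 0 <= alpha,
      forall j, cabs (om j.+1) <= cabs (om j),
      (forall j, Im (om j) <= 0) /\
      (forall J, \sum_(j < J) - Im (om j) <= Im (f 1%N / f 0%N)),
      forall J, \sum_(j < J) cabs (om j) ^+ 2 <= M &
      forall z, \prod_(j < J) primary_factor (om j * z) @[J --> \oo] -->
        fps_fun f z / (f 0%N * cexp (- (alpha%:C)%C * z ^+ 2 + f 1%N / f 0%N * z))].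
Proof.
have [s [M hs]] := exists_inverse_roots.
(* Limits along [\oo] persist along [U], and bounded sequences acquire limits; none of the
   conclusions mentions [n], so no subsequence has to be extracted. *)
have [U [UU hU]] := ultraFilterLemma (eventually_filter).
have PU : ProperFilter U := @ultra_proper _ _ UU.
have {}hs := hU _ hs.
have cvgU (V : topologicalType) (u : nat -> V) (l : V) :
    u n @[n --> \oo] --> l -> u n @[n --> U] --> l.
  by move=> h A /h hA; exact: (hU _ hA).
pose S1 : C := - (f 1%N / f 0%N).
pose S2 : C := S1 ^+ 2 - 2 * (f 2 / f 0%N).
have hS1 : (\sum_(w <- s n) w : C) @[n --> U] --> S1.
  have h := cvgU _ _ _ (cvg_inv_root_sum hf f0).
  apply: cvg_trans h; apply: near_eq_cvg; apply: filterS hs => n.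
  by move=> [_ _ _ _ []].
have hS2 : (\sum_(w <- s n) w ^+ 2 : C) @[n --> U] --> S2.
  have h := cvgU _ _ _ (cvg_inv_root_sum2 hf f0).
  apply: cvg_trans h; apply: near_eq_cvg; apply: filterS hs => n.
  by move=> [_ _ _ _ []].
have partial_le (g : C -> R) (t : seq C) (J : nat) : g 0 = 0 ->
    (forall w, w \in t -> 0 <= g w) -> \sum_(j < J) g (nth 0 t j) <= \sum_(w <- t) g w.
  move=> g0 hg; rewrite -big_take_nth // -{2}(cat_take_drop J t) big_cat lerDl /=.
  rewrite big_seq; apply: sumr_ge0 => w wd; apply: hg.
  exact: mem_drop wd.
have hbig : \forall n \near U, forall J, \sum_(j < J) cabs (nth 0 (s n) j) ^+ 2 <= M.
  apply: filterS hs => n [_ _ _ hM _] J; apply: le_trans hM.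
  apply: (partial_le (fun w => cabs w ^+ 2)); first by rewrite cabs0 expr0n.
  by move=> w _; apply: sqr_ge0.
have hlim j : exists l : C, nth 0 (s n) j @[n --> U] --> l.
  (* [y ^+ 2 <= M] implies [y <= M + 1]. *)
  apply: (ultra_bounded_cvgC (A := M + 1)); apply: filterS hbig => n /(_ j.+1).
  rewrite big_ord_recr /=; have : 0 <= \sum_(i < j) cabs (nth 0 (s n) i) ^+ 2.
    by apply: sumr_ge0 => i _; apply: sqr_ge0.
  set x := \sum_(i < j) _; set y := cabs _; nra.
have [om hom] := choice hlim.
have om_dec j : cabs (om j.+1) <= cabs (om j).
  have hc : cabs (nth 0 (s n) j) - cabs (nth 0 (s n) j.+1) @[n --> U] -->
      cabs (om j) - cabs (om j.+1).
    by apply: cvgB; apply: cvg_cabs; apply: hom.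
  rewrite -subr_ge0; apply: (cvgr_to_ge hc); apply: filterS hs => n [_ ss _ _ _].
  rewrite subr_ge0; have [js|js] := ltnP j.+1 (size (s n)).
    by have /(sortedP 0) := ss; apply.
  by rewrite [in leLHS]nth_default // cabs0 cabs_ge0.
have om_im j : Im (om j) <= 0.
  apply: (cvgr_to_le (cvgC_Im (hom j))); apply: filterS hs => n [_ _ hI _ _].
  have [js|js] := ltnP j (size (s n)); last by rewrite nth_default.
  by apply/hI/mem_nth.
have om_sum J : \sum_(j < J) - Im (om j) <= Im (f 1%N / f 0%N).
  have hc : - Im (\sum_(w <- s n) w) - \sum_(j < J) - Im (nth 0 (s n) j) @[n --> U] -->
      - Im S1 - \sum_(j < J) - Im (om j).
    apply: cvgB; first by apply: cvgN; apply: (cvgC_Im hS1).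
    apply: cvg_big => [|j _]; first exact: add_continuous.
    by apply: cvgN; apply: (cvgC_Im (hom j)).
  have eS : Im (f 1%N / f 0%N) = - Im S1 by rewrite /S1 raddfN opprK.
  rewrite -subr_ge0 eS.
  apply: (cvgr_to_ge hc); apply: filterS hs => n [_ _ hI _ _].
  rewrite subr_ge0 raddf_sum /= -sumrN.
  apply: (partial_le (fun w => - Im w)); first exact: oppr0.
  by move=> w ws; rewrite oppr_ge0 hI.
have om_sqr J : \sum_(j < J) cabs (om j) ^+ 2 <= M.
  have hc : \sum_(j < J) cabs (nth 0 (s n) j) ^+ 2 @[n --> U] -->
      \sum_(j < J) cabs (om j) ^+ 2.
    apply: cvg_big => [|j _]; first exact: add_continuous.
    by apply: cvgM; apply: cvg_cabs; apply: hom.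
  by apply: (cvgr_to_le hc); apply: filterS hbig => n; apply.
(* The limit along [U] of the sum of [w^2] past the [J]-th inverse root. What is left of it as [J]
   grows is the mass lost by [\sum w^2]. *)
pose D J : C := S2 - \sum_(j < J) om j ^+ 2.
have hD J : \sum_(w <- s n) w ^+ 2 - \sum_(j < J) nth 0 (s n) j ^+ 2 @[n --> U] --> D J.
  apply: cvgB; first exact: hS2.
  apply: cvg_big => [|j _]; first exact: add_continuous.
  by apply: cvgM; apply: hom.
have M0 : 0 <= M by have := om_sqr 0%N; rewrite big_ord0.
pose V := Im (f 1%N / f 0%N).
have V0 : 0 <= V by have := om_sum 0%N; rewrite big_ord0.
have near_nneg (e : R) J : (0 < J)%N -> 0 < e -> M <= e ^+ 2 * J%:R ->
    `|Im (D J)| <= 2 * e * V /\ - Re (D J) <= e * V.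
  move=> J0 e0 MJ.
  have hV : - Im (\sum_(w <- s n) w) @[n --> U] --> V.
    have -> : V = - Im S1 by rewrite /V /S1 raddfN opprK.
    by apply: cvgN; apply: (cvgC_Im hS1).
  have ht : \forall n \near U,
    let T := \sum_(w <- s n) w ^+ 2 - \sum_(j < J) nth 0 (s n) j ^+ 2 in
    `|Im T| <= 2 * e * - Im (\sum_(w <- s n) w) /\
    - Re T <= e * - Im (\sum_(w <- s n) w).
    apply: filterS hs => n [_ ss hI hM _].
    exact: sum_sqr_tail_near_nneg ss hM hI J0 e0 MJ.
  split.
    apply: (ler_cvg_to (cvg_norm (cvgC_Im (hD J))) (cvgM (cvg_cst (2 * e)) hV)).
    by apply: filterS ht => n [].
  apply: (ler_cvg_to (cvgN (cvgC_Re (hD J))) (cvgM (cvg_cst e) hV)).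
  by apply: filterS ht => n [].
have approx (z : C) (e : R) J : (0 < J)%N -> 0 < e -> M <= e ^+ 2 * J%:R ->
    e * cabs z <= 1 ->
    cabs (fps_fun f z - f 0%N * (cexp (- (S1 * z)) *
      \prod_(j < J) primary_factor (om j * z) * cexp (- (z ^+ 2 / 2 * D J)))) <=
    cabs (f 0%N) * (expR (cabs S1 * cabs z) * expR (M * cabs z ^+ 2 / 2) *
    (24 * e * M * cabs z ^+ 3 * expR (M * cabs z ^+ 2 / 2))).
  move=> J0 e0 MJ ez.
  have hb : coef_bounded fs := coef_bounded_of_coef0 hf f0 hu.
  have hp : ((fs n).[z] : C) @[n --> U] --> fps_fun f z.
    by apply: cvgU; apply: cvg_horner.
  have hp0 : ((fs n)`_0 : C) @[n --> U] --> f 0%N by apply: cvgU; apply: hf.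
  pose A n : C := cexp (- ((\sum_(w <- s n) w) * z)) *
    \prod_(j < J) primary_factor (nth 0 (s n) j * z) *
    cexp (- (z ^+ 2 / 2 * (\sum_(w <- s n) w ^+ 2 - \sum_(j < J) nth 0 (s n) j ^+ 2))).
  have hA : A n @[n --> U] --> (cexp (- (S1 * z)) *
      \prod_(j < J) primary_factor (om j * z) * cexp (- (z ^+ 2 / 2 * D J)) : C).
    apply: cvgM; last first.
      apply: cvg_cexp; apply: cvgN; apply: cvgM; [exact: cvg_cst|exact: hD].
    apply: cvgM.
      by apply: cvg_cexp; apply: cvgN; apply: cvgM; [exact: hS1|exact: cvg_cst].
    apply: cvg_big => [|j _]; first exact: mul_continuous.
    have hj : nth 0 (s n) j * z @[n --> U] --> om j * z.
      by apply: cvgM; [exact: hom|exact: cvg_cst].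
    apply: cvgM; last exact: cvg_cexp.
    by apply: cvgB; [exact: cvg_cst|exact: hj].
  have hE : expR (cabs (\sum_(w <- s n) w) * cabs z) @[n --> U] -->
      expR (cabs S1 * cabs z).
    have h : cabs (\sum_(w <- s n) w) * cabs z @[n --> U] --> cabs S1 * cabs z.
      by apply: cvgM; [apply: (cvg_cabs hS1)|exact: cvg_cst].
    exact: (@continuous_cvg _ _ _ U _ _ _ _ (@continuous_expR R _) h).
  have hl : cabs ((fs n).[z] - (fs n)`_0 * A n) @[n --> U] -->
      cabs (fps_fun f z - f 0%N * (cexp (- (S1 * z)) *
        \prod_(j < J) primary_factor (om j * z) * cexp (- (z ^+ 2 / 2 * D J)))).
    by apply: cvg_cabs; apply: cvgB; [exact: hp|apply: cvgM; [exact: hp0|exact: hA]].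
  have hr : cabs (fs n)`_0 * (expR (cabs (\sum_(w <- s n) w) * cabs z) *
      expR (M * cabs z ^+ 2 / 2) *
      (24 * e * M * cabs z ^+ 3 * expR (M * cabs z ^+ 2 / 2))) @[n --> U] -->
      cabs (f 0%N) * (expR (cabs S1 * cabs z) * expR (M * cabs z ^+ 2 / 2) *
      (24 * e * M * cabs z ^+ 3 * expR (M * cabs z ^+ 2 / 2))).
    apply: cvgM; first exact: (cvg_cabs hp0).
    apply: cvgM; last exact: cvg_cst.
    apply: cvgM; [exact: hE|exact: cvg_cst].
  apply: (ler_cvg_to hl hr); apply: filterS hs => n [hpn ss hI hM _].
  have -> : (fs n).[z] = (fs n)`_0 * \prod_(w <- s n) (1 - w * z).
    rewrite {1}hpn hornerZ horner_prod; congr (_ * _).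
    by apply: eq_bigr => w _; rewrite !hornerE.
  rewrite /= -mulrBr cabsM; apply: ler_wpM2l; first exact: cabs_ge0.
  exact: prod_1B_approx ss hM J0 e0 MJ ez.
have [Dl hDl] : exists Dl : C, D J @[J --> \oo] --> Dl.
  have [|l hl] := @cvg_sum_of_bounded_cabs R (fun j => om j ^+ 2) M.
    by move=> J; under eq_bigr do rewrite cabsX; apply: om_sqr.
  by exists (S2 - l); apply: cvgB; [exact: cvg_cst|exact: hl].
have large (e : R) : 0 < e -> \forall J \near \oo, (0 < J)%N /\ M <= e ^+ 2 * J%:R.
  move=> e0; have e2 : 0 < e ^+ 2 by rewrite exprn_gt0.
  exists (Num.truncn (M / e ^+ 2)).+1 => // J /= hJ; split; first exact: leq_trans hJ.
  rewrite mulrC -ler_pdivrMr //; apply: (@le_trans _ _ (Num.truncn (M / e ^+ 2)).+1%:R).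
    exact/ltW/truncnS_gt.
  by rewrite ler_nat.
have ImDl : Im Dl = 0.
  apply/eqP; rewrite -normr_le0; apply: (@le0_of_le_small _ _ (2 * V)).
    by rewrite mulr_ge0.
  move=> e e0; apply: (cvgr_to_le (cvg_norm (cvgC_Im hDl))).
  apply: filterS (large e e0) => J [J0 MJ].
  by have [h _] := near_nneg e J J0 e0 MJ; rewrite mulrCA mulrA.
have ReDl : 0 <= Re Dl.
  rewrite -oppr_le0; apply: (@le0_of_le_small _ _ V) => // e e0.
  apply: (cvgr_to_le (cvgN (cvgC_Re hDl))).
  apply: filterS (large e e0) => J [J0 MJ].
  by have [_ h] := near_nneg e J J0 e0 MJ.
exists om, M, (Re Dl / 2); split.
- by rewrite divr_ge0.
- exact: om_dec.
- by split; [exact: om_im|exact: om_sum].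
- exact: om_sqr.
move=> z.
(* [c J] and its limit do not vanish, so from [f - c J * Q J -> 0] the convergence of [Q J] follows
   by division. *)
pose c J : C := f 0%N * (cexp (- (S1 * z)) * cexp (- (z ^+ 2 / 2 * D J))).
pose Q J : C := \prod_(j < J) primary_factor (om j * z).
have c0 J : c J != 0 by rewrite mulf_neq0 // mulf_neq0 // cexp_neq0.
have hc : c J @[J --> \oo] -->
    (f 0%N * cexp (- ((Re Dl / 2)%:C)%C * z ^+ 2 + f 1%N / f 0%N * z) : C).
  have -> : - ((Re Dl / 2)%:C)%C * z ^+ 2 + f 1%N / f 0%N * z =
      - (S1 * z) + - (z ^+ 2 / 2 * Dl).
    have -> : Dl = ((Re Dl)%:C)%C by apply: complex_eqP.
    by rewrite /S1 rmorphM fmorphV rmorph_nat /=; field.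
  rewrite cexpD; apply: cvgM; first exact: cvg_cst.
  apply: cvgM; first exact: cvg_cst.
  by apply: cvg_cexp; apply: cvgN; apply: cvgM; [exact: cvg_cst|exact: hDl].
have hQ : fps_fun f z - c J * Q J @[J --> \oo] --> (0 : C).
  apply/cvgCP => e e0.
  pose K := cabs (f 0%N) * (expR (cabs S1 * cabs z) * expR (M * cabs z ^+ 2 / 2) *
    (24 * M * cabs z ^+ 3 * expR (M * cabs z ^+ 2 / 2))).
  have K0 : 0 <= K.
    by rewrite !mulr_ge0 ?expR_ge0 ?exprn_ge0 ?cabs_ge0.
  have K1 : 0 < K + 1 by rewrite ltr_wpDl.
  have z1 : 0 < cabs z + 1 by rewrite ltr_wpDl ?cabs_ge0.
  (* The error in [approx] is [d * K]: the first term makes it smaller than [e], the second ensures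
     [d * cabs z <= 1]. *)
  pose d := Num.min (e / (K + 1)) (cabs z + 1)^-1.
  have d0 : 0 < d by rewrite lt_min divr_gt0 //= invr_gt0.
  apply: filterS (large d d0) => J [J0 MJ].
  have dz : d * cabs z <= 1.
    apply: (@le_trans _ _ ((cabs z + 1)^-1 * cabs z)).
      by rewrite ler_wpM2r ?cabs_ge0 // ge_min lexx orbT.
    by rewrite mulrC ler_pdivrMr // mul1r lerDl.
  have h := approx z d J J0 d0 MJ dz.
  rewrite sub0r cabsN.
  have -> : c J * Q J = f 0%N * (cexp (- (S1 * z)) * Q J * cexp (- (z ^+ 2 / 2 * D J))).
    by rewrite /c -mulrA [cexp (- (S1 * z)) * Q J * _]mulrAC.
  apply: le_lt_trans h _.
  rewrite (_ : cabs (f 0%N) * _ = d * K); last by rewrite /K; ring.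
  apply: (@le_lt_trans _ _ (e / (K + 1) * K)).
    by rewrite ler_wpM2r // ge_min lexx.
  by rewrite mulrAC ltr_pdivrMr // ltr_pM2l // ltrDl.
have hQ' : (fps_fun f z - (fps_fun f z - c J * Q J)) / c J @[J --> \oo] -->
    (fps_fun f z - 0) / (f 0%N * cexp (- ((Re Dl / 2)%:C)%C * z ^+ 2 + f 1%N / f 0%N * z)).
  apply: cvgM; first by apply: cvgB; [exact: cvg_cst|exact: hQ].
  by apply: cvgV; [rewrite mulf_neq0 ?cexp_neq0|exact: hc].
rewrite subr0 in hQ'; apply: cvg_trans hQ'; apply: near_eq_cvg.
apply: nearW => J; rewrite opprB addrC subrK mulrAC divff ?mul1r //.
Qed.

End Product_representation.

(** * Membership in the Pólya-Obrechkoff class *)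

Section Polya_Obrechkoff_class.
Variable R : realType.
Local Notation C := (Cplx R).
Local Notation Re := (@complex.Re R).
Local Notation Im := (@complex.Im R).
Implicit Types (fs : nat -> {poly R[i]}) (f : nat -> C).

(** As the moduli decrease, all entries after a zero one vanish, so the nonzero entries form an
    initial segment. *)
Lemma exists_in_length (om : nat -> C) :
  (forall j, cabs (om j.+1) <= cabs (om j)) ->
  exists N, forall j, in_length N j = (om j != 0).
Proof.
move=> dec; have [ex|nex] := pselect (exists j, om j == 0); last first.
  by exists None => j /=; apply/esym/negP => oj; apply: nex; exists j.
exists (Some (ex_minn ex)) => j /=; case: ex_minnP => m om0 hm.
have [jm|mj] := ltnP j m.
  by apply/esym; apply: contraTneq jm => oj; rewrite -leqNgt hm // oj.
rewrite -(subnK mj); elim: (j - m)%N => [|k IH]; first by rewrite add0n om0.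
apply/esym/negbTE; move/esym/negbFE: IH; rewrite negbK -!cabs_eq0 => /eqP h.
by rewrite addSn eq_le cabs_ge0 andbT -h dec.
Qed.

Lemma nneseries_le (u : nat -> R) (P : pred nat) (B : R) :
  (forall j, P j -> 0 <= u j) -> (forall J, \sum_(0 <= j < J | P j) u j <= B) ->
  (\sum_(0 <= j <oo | P j) (u j)%:E <= B%:E)%E.
Proof.
move=> u0 hB; apply: lime_le.
  by apply: is_cvg_nneseries_cond => j _ Pj; rewrite lee_fin u0.
by apply: nearW => J; rewrite sumEFin lee_fin.
Qed.

Lemma PO_of_coef0 fs f : coef_cvg fs f -> f 0%N != 0 ->
  (\forall n \near \oo, uhp_roots (fs n)) -> PO R (fps_fun f).
Proof.
move=> hf f0 hu; have hb := coef_bounded_of_coef0 hf f0 hu.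
split; first exact: coef_bounded_entire hf hb.
have [om [M [alpha [a0 dec [hI hIs] hM hprod]]]] := product_representation hf f0 hu.
have [N hN] := exists_in_length dec.
(* [beta] is minus the limit of [\sum w]. Past the length [N] the inverse of [om j = 0] is [0], and
   [in_length] discards these terms. *)
exists (f 0%N), (f 1%N / f 0%N), 0%N, alpha, N, (fun j => (om j)^-1).
split.
- exact: a0.
- move=> j; rewrite hN => oj; split; last by apply/eqP; rewrite invr_eq0.
  by rewrite /uhp /= leNgt; apply/negP => /Im_inv_gt0; rewrite invrK ltNge hI.
- apply: le_lt_trans (ltry M); apply: nneseries_le.
    by move=> j _; rewrite invr_ge0 exprn_ge0 ?cabs_ge0.
  move=> J; apply: le_trans (hM J); rewrite big_mkcond big_mkord.
  apply: ler_sum => j _; case: ifP => _; last exact: sqr_ge0.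
  by rewrite cabsV exprVn invrK.
- apply: nneseries_le.
    move=> j _; rewrite invrK raddfN oppr_ge0; exact: hI.
  move=> J; apply: le_trans (hIs J); rewrite big_mkcond big_mkord.
  by apply: ler_sum => j _; rewrite invrK raddfN; case: ifP => // _; rewrite oppr_ge0.
- move=> z.
  have hQ : partial_prod N (fun j => (om j)^-1) z =
      (fun J => \prod_(j < J) primary_factor (om j * z)).
    apply/funext => J; rewrite /partial_prod big_mkcond big_mkord.
    apply: eq_bigr => j _; rewrite invrK [om j * z]mulrC hN.
    have [->|_] := eqVneq (om j) 0.
    by rewrite /primary_factor mulr0 subr0 cexp0 mulr1.
    by [].
  rewrite hQ; split; first by apply/cvg_ex; eexists; exact: hprod.
  rewrite (norm_cvg_lim (hprod z)) expr0 mulr1 mulrC divfK //.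
  by rewrite mulf_neq0 ?cexp_neq0.
Qed.

Lemma PO_mulz (g F : C -> C) : PO R g -> entire F -> (forall z, F z = z * g z) ->
  PO R F.
Proof.
move=> [_ [c [beta [m [alpha [N [a [h1 h2 h3 h4 h5]]]]]]]] eF hF.
split => //; exists c, beta, m.+1, alpha, N, a; split => // z.
have [cv hz] := h5 z; split; first exact: cv.
by rewrite hF hz (exprS z m) [c * (z * z ^+ m)]mulrCA -!mulrA.
Qed.

(** Each induction step divides out one root tending to [0], which changes both the polynomials and
    the limit, and restores the factor [z] by [PO_mulz]. *)
Lemma PO_of_uhp_roots fs f m : coef_cvg fs f -> coef_bounded fs ->
  (\forall n \near \oo, uhp_roots (fs n)) ->
  (forall k, (k < m)%N -> f k = 0) -> f m != 0 -> PO R (fps_fun f).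
Proof.
elim: m fs f => [|m IH] fs f hf hb hu flow fm; first exact: PO_of_coef0 hf fm hu.
have [gs [gc gb gu hg]] := divide_small_root hf hb hu (flow 0%N (ltn0Sn m)) fm.
apply: PO_mulz hg; last exact: coef_bounded_entire hf hb.
by apply: (IH gs) => // k km; apply: flow.
Qed.

End Polya_Obrechkoff_class.

Theorem theorem1p1 (R : realType) (fs : nat -> {poly R[i]})
    (f : nat -> Cplx R) :
  cvg_weakly fs f ->
  (exists k, f k != 0) ->
  (forall n, zeros (horner (fs n) : Cplx R -> Cplx R) `<=` uhp R) ->
  [/\ represents_entire f,
      PO R (fps_fun f) &
      cvg_strongly (fun n => horner (fs n)) (fps_fun f)].
Proof.
move=> hw [k fk] hz.
have hf := cvg_weakly_coef hw.
have hu := near_uhp_roots hf fk hz.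
have hb := coef_bounded_of_uhp hf fk hu.
have ex : exists m, f m != 0 by exists k.
split.
- exact: coef_bounded_represents_entire hf hb.
- case: (ex_minnP ex) => m fm hm.
  apply: (PO_of_uhp_roots hf hb hu _ fm) => j jm.
  by apply/eqP/negPn/negP => /hm; rewrite leqNgt jm.
- exact: coef_bounded_strong hf hb.
Qed.
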